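(* Fix $\delta\in(0,\pi/4)$. For any $h\in C^1(S^1,\mathbb{R})$ and $\eta>0$ there exist $\varepsilon_0>0$, $N_0>0$, $\beta_0>0$, $\kappa>0$ and a nonempty open set $\mathcal{I}\subset\mathbb{R}$ such that the following holds for any $\beta>\beta_0$, $N>N_0$ and $0\le k\le\kappa N$. Suppose only $k$ of the leaves are coupled, that is, there is a set $I\subset\{1,\dots,N\}$ with $|I|=k$ such that $A_{ii}=1$ for $i\in I$ and all other entries of the adjacency matrix $A$ vanish. Then for any $0<\varepsilon\le\varepsilon_0$, $\sigma\in\mathcal{I}$ and any initial condition on $M_\varepsilon$, the solution of the coupled system stays in a product of coherent and incoherent states for all time, i.e. $r^+>1-\eta$ and $r^-<\eta$ for all $t\ge0$ (even though the solution may leave $M_\varepsilon$).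
   Context: Notation: $S^1=\mathbb{R}/2\pi\mathbb{Z}$, $\mathbb{T}^n=(S^1)^n$, $\mathbb{D}=\{w\in\mathbb{C}:|w|<1\}$. Coupled star network with coupling structure $A$. For $N\in\mathbb{N}$ leaves per star, hub frequency $\beta>1$, $\sigma>0$, $\delta\in(0,\pi/4)$, $\varepsilon\ge0$, $h:S^1\to\mathbb{R}$ and a matrix $A=(A_{ij})_{0\le i,j\le N}$, the phases $\varphi_0^\pm$ (hubs) and $\varphi_i^\pm$ (leaves), $i=1,\dots,N$, satisfy $$\dot\varphi_0^\pm=\beta+\beta\tfrac{\sigma}{N}\sum_{j=1}^N\sin(\varphi_j^\pm-\varphi_0^\pm+\delta)+\varepsilon\sum_{j=0}^NA_{0j}h(\varphi_0^\pm-\varphi_j^\mp),$$ $$\dot\varphi_i^\pm=1+\sigma\sin(\varphi_0^\pm-\varphi_i^\pm+\delta)+\varepsilon\sum_{j=0}^NA_{ij}h(\varphi_i^\pm-\varphi_j^\mp),\quad i=1,\dots,N.$$ Relative phases are $\phi_i^\pm=\varphi_i^\pm-\varphi_0^\pm$. The ''$+$'' star is described by $(\varphi_0^+,\phi_1^+,\dots,\phi_N^+)\in\mathbb{T}^{N+1}$. Lifted coordinates for the ''$-$'' star. Let $Q^-=S^1\times\mathbb{D}\times S^1\times\mathbb{T}^N\ni(\varphi_0^-,\alpha,\psi,\theta)$, with relative phases given by $e^{i\phi_j^-}=M_{\alpha,\psi}(e^{i\theta_j})$, where $M_{\alpha,\psi}(w)=\frac{\alpha+e^{i\psi}w}{1+\bar\alpha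 e^{i\psi}w}$. Put $z=z(\alpha,\psi,\theta)=\frac1N\sum_{j=1}^N M_{\alpha,\psi}(e^{i\theta_j})$, $f=\frac{-\sigma e^{-i\delta}}{2i}$, $g=1-\beta-\sigma\beta\,\frac{ze^{i\delta}-\bar z e^{-i\delta}}{2i}$. For the sparse coupling above, the lifted coupled system consists of the equations for $\varphi_0^\pm$, $\phi_i^+$ together with $\dot\alpha=i(f\alpha^2+g\alpha+\bar f)$, $\dot\psi=f\alpha+g+\bar f\bar\alpha$, $$\dot\theta_i=\varepsilon\,\frac{|\alpha+e^{i(\psi+\theta_i)}|^2}{1-|\alpha|^2}\,h\bigl(\phi_i^--\phi_i^++\varphi_0^--\varphi_0^+\bigr)\ (i\in I),\qquad \dot\theta_i=0\ (i\notin I),$$ which projects onto the original coupled system. Order parameters: $r^+=\bigl|\frac1N\sum_{j=1}^N e^{i\phi_j^+}\bigr|$ and $r^-=|z(\alpha,\psi,\theta)|$. The manifolds. For $\varepsilon=0$: $M_+=\{\phi_1^+=\dots=\phi_N^+=\phi^C,\ \varphi_0^+\in S^1\}$ with $$\phi^C=\delta-\pi+\arctan\Bigl(\frac{1+\beta\cos2\delta}{\beta\sin2\delta}\Bigr)+\arccos\Bigl(\frac{\beta-1}{\sigma\sqrt{1+\beta^2+2\beta\cos2\delta}}\Bigr);$$ $M_-=\{\alpha=\alpha^I+g^I(\psi,\theta),\ \psi\in S^1,\ \theta\in U,\ \varphi_0^-\in S^1\}$, where $\arg\alpha^I=-\frac\pi2+\delta$, $|\alpha^I|=\frac{\beta-1-\sqrt{(\beta-1)^2-\sigma^2(1+2\beta\cos2\delta)}}{\sigma(1+2\beta\cos2\delta)}$;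 $U\subset\mathbb{T}^N$ is a suitable (sufficiently small) open neighborhood of the set $\Theta$ of uniformly distributed states (those $\theta$ for which there is $\varphi\in S^1$ with $\theta_j=\frac{2\pi j}{N}+\varphi$ up to permutation of indices); and $g^I$ is a $C^1$ function, $C^1$-small for $N$ large, for which $M_-$ is a normally attracting invariant manifold of the uncoupled ''$-$'' star. $M_\varepsilon$ denotes the normally attracting invariant manifold with boundary of the coupled system which is the perturbation of $M=M_+\times M_-$ and is $\mathcal{O}(\varepsilon)$-close to it: $$M_\varepsilon=\{\phi_i^+=\phi^C+\tilde g_i^C(\varphi_0^\pm,\psi,\theta),\ \alpha=\alpha^I+(g^I+\tilde g^I)(\varphi_0^\pm,\psi,\theta),\ \varphi_0^\pm,\psi\in S^1,\ \theta\in U\},$$ $\|\tilde g^C\|_{C^1},\|\tilde g^I\|_{C^1}\in\mathcal{O}(\varepsilon)$. It is normally attracting and invariant after the coupled vector field has been modified only in an arbitrarily small neighborhood over $\theta\in\partial U$; unmodified solutions can leave $M_\varepsilon$ only by $\theta$ crossing $\partial U$. Normally attracting invariant manifold (NAIM). For a $C^1$ vector field with flow $\Phi^t$, a submanifold $M$ is a NAIM if: (1) $\Phi^t(M)=M$ for all $t$; (2) there is a continuous splitting of the ambient tangent bundle over $M$ as $TM\oplus \mathcal N$ with continuous projections, invariant under the tangent flow $T\Phi^t=T\Phi^t_M\oplus T\Phi^t_{\mathcal N}$; (3) there are $a<b\le0$ and $C>0$ with $\|T\Phi_M^t v\|\le Ce^{bt}\|v\|$ for $t\le0$, $v\in TM$,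 and $\|T\Phi_{\mathcal N}^t v\|\le Ce^{at}\|v\|$ for $t\ge0$, $v\in \mathcal N$. *)

(* Defs.v *)
From HB Require Import structures.
From mathcomp Require Import all_boot all_order all_algebra.
From mathcomp Require Import perm complex.
From mathcomp Require Import all_classical all_reals all_analysis.

Set Implicit Arguments.
Unset Strict Implicit.
Unset Printing Implicit Defensive.

Import Order.TTheory GRing.Theory Num.Theory.
Import numFieldNormedType.Exports.

Local Open Scope classical_set_scope.
Local Open Scope ring_scope.

(* Conventions (MathComp-Analysis, R : realType).
   - Points of S^1 = R/2piZ are represented by real lifts: maps on S^1 are
     2pi-periodic maps on R, and subsets of a torus are 2piZ^n-invariant
     subsets of R^n.
   - The disc coordinate alpha is stored as a pair of reals, so that the state
     space is a normed space over R; complex formulas are evaluated in R[i].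
   - Leaves 1..N are indexed by 'I_N; the rows and columns 0..N of A by
     'I_N.+1, with 0 = ord0 the hub and lift ord0 i the leaf i. *)

(** * C^1 maps, flows, normally attracting invariant manifolds *)

Definition C1_on (R : realType) (V W : normedModType R) (D : set V)
    (F : V -> W) : Prop :=
  forall x, D x -> differentiable F x /\
    forall v, {for x, continuous (fun y => 'D_v F y)}.

(* ||F||_{C^1(D)} <= c, the C^1 norm being the maximum of the sup norms of F
   and of its partial derivatives.  (The operator norm of dF for the sup norm
   on R^n would not do: it does not become small with N for g^I.) *)
Definition C1_norm_le (R : realType) (n : nat) (W : normedModType R)
    (D : set 'rV[R]_n) (F : 'rV[R]_n -> W) (c : R) : Prop :=
  C1_on D F /\
  forall y, D y -> `|F y| <= c /\
    forall i : 'I_n, `|'D_(delta_mx 0 i) F y| <= c.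

Definition twopi_vec (R : realType) (n : nat) (k : 'rV[int]_n) : 'rV[R]_n :=
  \row_i (2 * pi * (k 0 i)%:~R).

Definition periodic_set (R : realType) (n : nat) (D : set 'rV[R]_n) : Prop :=
  forall y k, D y -> D (y + twopi_vec R k).

Definition periodic_on (R : realType) (n : nat) (W : Type)
    (D : set 'rV[R]_n) (F : 'rV[R]_n -> W) : Prop :=
  forall y k, D y -> F (y + twopi_vec R k) = F y.

Definition is_flow (R : realType) (V : normedModType R) (Om : set V)
    (X : V -> V) (Phi : R -> V -> V) : Prop :=
  forall x, Om x -> Phi 0 x = x /\
    forall t, Om (Phi t x) /\ is_derive t 1 (fun s => Phi s x) (X (Phi t x)).

(* v is tangent to M at x: the velocity of a curve in M through x. *)
Definition tangent (R : realType) (V : normedModType R) (M : set V)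
    (x v : V) : Prop :=
  exists c : R -> V, [/\ c 0 = x, \forall t \near (0 : R), M (c t) &
    is_derive (0 : R) 1 c v].

(* Normally attracting invariant manifold M of the C^1 field X on the open set
   Om.  P x is the projection of the ambient tangent space onto T_xM along N_x,
   so that N_x = ker (P x); the tangent flow is the differential of Phi t.
   When angles are lifted to R the splitting descends to the torus: by (3) the
   space N_x is unique, being the set of vectors that decay at rate a. *)
Definition is_NAIM (R : realType) (V : normedModType R) (Om : set V)
    (X : V -> V) (M : set V) : Prop :=
  [/\ M `<=` Om, C1_on Om X &
  exists Phi : R -> V -> V, is_flow Om X Phi /\
  (forall t, Phi t @` M = M) /\
  exists P : V -> {linear V -> V},
  [/\ (forall x, M x -> forall v,
         tangent M x (P x v) /\ (tangent M x v -> P x v = v)),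
      (forall v, {within M, continuous (fun x => P x v)}),
      (forall x, M x -> forall t v,
         P (Phi t x) ('d (Phi t) x v) = 'd (Phi t) x (P x v)) &
      exists a b C : R, [/\ a < b, b <= 0, 0 < C,
        (forall x v t, M x -> tangent M x v -> t <= 0 ->
           `|'d (Phi t) x v| <= C * expR (b * t) * `|v|) &
        (forall x v t, M x -> P x v = 0 -> 0 <= t ->
           `|'d (Phi t) x v| <= C * expR (a * t) * `|v|)]]].

(* X solves x' = F x on [0, T[ inside Om. *)
Definition is_solution (R : realType) (V : normedModType R) (Om : set V)
    (F : V -> V) (T : R) (X : R -> V) : Prop :=
  [/\ (forall t, 0 <= t < T -> Om (X t)),
      {within `[0, T[, continuous X} &
      forall t, 0 < t < T -> is_derive t 1 X (F (X t))].

(** * Complex formulas *)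

Definition expi (R : realType) (t : R) : R[i] := Complex (cos t) (sin t).

(* An angle of w, for |w| = 1. *)
Definition angle (R : realType) (w : R[i]) : R :=
  if 0 <= complex.Im w then acos (complex.Re w) else - acos (complex.Re w).

Definition mobius (R : realType) (alpha : R[i]) (psi : R) (w : R[i]) : R[i] :=
  (alpha + expi psi * w) / (1 + conjc alpha * expi psi * w).

Definition zmean (R : realType) (N : nat) (alpha : R[i]) (psi : R)
    (theta : 'rV[R]_N) : R[i] :=
  N%:R^-1 * \sum_j mobius alpha psi (expi (theta 0 j)).

Definition fcoef (R : realType) (delta sigma : R) : R[i] :=
  - (Complex sigma 0 * expi (- delta)) / (2 * Complex 0 1).

Definition gcoef (R : realType) (delta beta sigma : R) (z : R[i]) : R[i] :=
  1 - Complex beta 0 - Complex (sigma * beta) 0 *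
    ((z * expi delta - conjc z * expi (- delta)) / (2 * Complex 0 1)).

(** * The coupled star network *)

(* Right-hand side of the equation for phi_i^(+-), i = 0..N; phi are the phases
   of the star itself and chi those of the other star. *)
Definition star_rate (R : realType) (N : nat) (delta beta sigma eps : R)
    (h : R -> R) (A : 'M[R]_N.+1) (phi chi : 'I_N.+1 -> R) (i : 'I_N.+1) : R :=
  (if i == ord0 then
     beta + beta * (sigma / N%:R) *
       \sum_(j < N) sin (phi (lift ord0 j) - phi ord0 + delta)
   else 1 + sigma * sin (phi ord0 - phi i + delta))
  + eps * \sum_j A i j * h (phi i - chi j).

Definition sparse_coupling (R : realType) (N : nat) (I : {set 'I_N})
    (A : 'M[R]_N.+1) : Prop :=
  (forall i, i \in I -> A (lift ord0 i) (lift ord0 i) = 1) /\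
  (forall j l, ~ (exists2 i, i \in I & j = lift ord0 i /\ l = lift ord0 i) ->
     A j l = 0).

(* (phi_0^+, (phi_i^+)_i), the phi_i^+ being relative phases *)
Definition plus_state (R : realType) (N : nat) : normedModType R :=
  (R * 'rV[R]_N)%type.

(* (((phi_0^-, alpha), psi), theta) *)
Definition minus_state (R : realType) (N : nat) : normedModType R :=
  (R * (R * R) * R * 'rV[R]_N)%type.

Definition state (R : realType) (N : nat) : normedModType R :=
  (plus_state R N * minus_state R N)%type.

Section Coordinates.
Context (R : realType) (N : nat).

Definition to_complex (p : R * R) : R[i] := Complex p.1 p.2.

Definition hubP (s : plus_state R N) : R := s.1.
Definition relP (s : plus_state R N) : 'rV[R]_N := s.2.
Definition hubM (s : minus_state R N) : R := s.1.1.1.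
Definition alphaM (s : minus_state R N) : R[i] := to_complex s.1.1.2.
Definition psiM (s : minus_state R N) : R := s.1.2.
Definition thetaM (s : minus_state R N) : 'rV[R]_N := s.2.

Definition with_hub (hub : R) (rel : 'I_N -> R) (i : 'I_N.+1) : R :=
  if unlift ord0 i is Some j then rel j + hub else hub.

Definition phases_plus (s : plus_state R N) : 'I_N.+1 -> R :=
  with_hub (hubP s) (fun j => relP s 0 j).

Definition phases_minus (s : minus_state R N) : 'I_N.+1 -> R :=
  with_hub (hubM s)
    (fun j => angle (mobius (alphaM s) (psiM s) (expi (thetaM s 0 j)))).

Definition minus_domain : set (minus_state R N) :=
  [set s | Normc.normc (alphaM s) < 1].

Definition domain : set (state R N) := [set s | minus_domain s.2].

Definition order_plus (s : state R N) : R :=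
  Normc.normc (N%:R^-1 * \sum_j expi (relP s.1 0 j)).

Definition order_minus (s : state R N) : R :=
  Normc.normc (zmean (alphaM s.2) (psiM s.2) (thetaM s.2)).

(* Translations of the state by full turns of the angular coordinates. *)
Definition state_period (a b c : int) (v w : 'rV[int]_N) : state R N :=
  ((2 * pi * a%:~R, twopi_vec R v),
   (2 * pi * b%:~R, (0, 0), 2 * pi * c%:~R, twopi_vec R w)).

End Coordinates.

Definition plus_field (R : realType) (N : nat) (delta beta sigma eps : R)
    (h : R -> R) (A : 'M[R]_N.+1) (chi : 'I_N.+1 -> R)
    (s : plus_state R N) : plus_state R N :=
  let rate := star_rate delta beta sigma eps h A (phases_plus s) chi in
  (rate ord0, \row_i (rate (lift ord0 i) - rate ord0)).

(* Lifted equations of the "-" star; phi are the phases of the "+" star. *)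
Definition minus_field (R : realType) (N : nat) (delta beta sigma eps : R)
    (h : R -> R) (A : 'M[R]_N.+1) (I : {set 'I_N}) (phi : 'I_N.+1 -> R)
    (s : minus_state R N) : minus_state R N :=
  let alpha := alphaM s in
  let chi := phases_minus s in
  let f := fcoef delta sigma in
  let g := gcoef delta beta sigma (zmean alpha (psiM s) (thetaM s)) in
  let dalpha := Complex 0 1 * (f * alpha ^+ 2 + g * alpha + conjc f) in
  let dpsi := f * alpha + g + conjc f * conjc alpha in
  let factor i := Normc.normc (alpha + expi (psiM s + thetaM s 0 i)) ^+ 2 /
                  (1 - Normc.normc alpha ^+ 2) in
  (star_rate delta beta sigma eps h A chi phi ord0,
   (complex.Re dalpha, complex.Im dalpha),
   complex.Re dpsi,
   \row_i (if i \in I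
           then eps * factor i * h (chi (lift ord0 i) - phi (lift ord0 i))
           else 0)).

Definition lifted_field (R : realType) (N : nat) (delta beta sigma eps : R)
    (h : R -> R) (A : 'M[R]_N.+1) (I : {set 'I_N})
    (s : state R N) : state R N :=
  (plus_field delta beta sigma eps h A (phases_minus s.2) s.1,
   minus_field delta beta sigma eps h A I (phases_plus s.1) s.2).

(** * The invariant manifolds *)

Definition phiC (R : realType) (delta beta sigma : R) : R :=
  delta - pi
  + atan ((1 + beta * cos (2 * delta)) / (beta * sin (2 * delta)))
  + acos ((beta - 1) /
      (sigma * Num.sqrt (1 + beta ^+ 2 + 2 * beta * cos (2 * delta)))).

Definition alphaI (R : realType) (delta beta sigma : R) : R[i] :=
  Complex
    ((beta - 1 - Num.sqrt ((beta - 1) ^+ 2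
        - sigma ^+ 2 * (1 + 2 * beta * cos (2 * delta)))) /
     (sigma * (1 + 2 * beta * cos (2 * delta)))) 0
  * expi (- (pi / 2) + delta).

(* Parameters for which M = M_+ x M_- is available: the argument of arccos in
   phiC and that of the square root in alphaI are admissible, and the
   transverse eigenvalues of M_+,
     - sigma cos(phiC - delta)
   (N - 1 times: differences of leaves) and
     - sigma cos(phiC - delta) - beta sigma cos(phiC + delta)
   (common shift of the leaves), are negative. *)
Definition bistable (R : realType) (delta beta sigma : R) : Prop :=
  [/\ 0 < sigma,
      beta - 1 < sigma * Num.sqrt (1 + beta ^+ 2 + 2 * beta * cos (2 * delta)),
      sigma ^+ 2 * (1 + 2 * beta * cos (2 * delta)) < (beta - 1) ^+ 2,
      0 < cos (phiC delta beta sigma - delta) &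
      0 < cos (phiC delta beta sigma - delta)
          + beta * cos (phiC delta beta sigma + delta)].

(* The set Theta of uniformly distributed states. *)
Definition uniform_states (R : realType) (N : nat) : set 'rV[R]_N :=
  [set theta | exists (phi : R) (s : {perm 'I_N}) (m : 'I_N -> int),
     forall j, theta 0 j =
       2 * pi * (s j).+1%:R / N%:R + phi + 2 * pi * (m j)%:~R].

Arguments uniform_states : clear implicits.

(* U is an open neighbourhood of Theta in the torus, within distance rho. *)
Definition small_nbhd (R : realType) (N : nat) (rho : R)
    (U : set 'rV[R]_N) : Prop :=
  [/\ open U, periodic_set U, uniform_states R N `<=` U &
      forall theta, U theta ->
        exists2 theta0, uniform_states R N theta0 & `|theta - theta0| < rho].

Section Manifolds.
Context (R : realType) (N : nat) (delta beta sigma : R) (U : set 'rV[R]_N).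

Definition base1 (psi : R) (theta : 'rV[R]_N) : 'rV[R]_(1 + N) :=
  row_mx psi%:M theta.

Definition base1_dom : set 'rV[R]_(1 + N) := [set y | U (rsubmx y)].

Definition base3 (p m psi : R) (theta : 'rV[R]_N) : 'rV[R]_(1 + (1 + (1 + N))) :=
  row_mx p%:M (row_mx m%:M (base1 psi theta)).

Definition base3_dom : set 'rV[R]_(1 + (1 + (1 + N))) :=
  [set y | U (rsubmx (rsubmx (rsubmx y)))].

Context (gI : 'rV[R]_(1 + N) -> R * R).

Definition M_minus : set (minus_state R N) :=
  [set s | U (thetaM s) /\
     alphaM s = alphaI delta beta sigma
                + to_complex (gI (base1 (psiM s) (thetaM s)))].

(* g^I is C^1, of C^1 norm at most rho, and M_- is a NAIM of the uncoupled "-"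
   star (the phases of the "+" star are irrelevant for eps = 0). *)
Definition is_M_minus (rho : R) : Prop :=
  [/\ periodic_on base1_dom gI, C1_norm_le base1_dom gI rho &
      is_NAIM (@minus_domain R N)
        (minus_field delta beta sigma 0 (fun=> 0) 0 finset.set0 (fun=> 0)) M_minus].

Context (tgC : 'I_N -> 'rV[R]_(1 + (1 + (1 + N))) -> R)
  (tgI : 'rV[R]_(1 + (1 + (1 + N))) -> R * R).

Definition M_eps : set (state R N) :=
  [set s | let y := base3 (hubP s.1) (hubM s.2) (psiM s.2) (thetaM s.2) in
     [/\ U (thetaM s.2),
         (forall i, exists m : int,
            relP s.1 0 i = phiC delta beta sigma + tgC i y + 2 * pi * m%:~R) &
         alphaM s.2 = alphaI delta beta sigma
           + (to_complex (gI (base1 (psiM s.2) (thetaM s.2)))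
              + to_complex (tgI y))]].

(* M_eps is C eps-close to M in C^1, and is a NAIM of a field on the torus
   bundle that agrees with the coupled field except over the omega-neighbourhood
   of the boundary of U. *)
Definition is_M_eps (eps : R) (h : R -> R) (A : 'M[R]_N.+1) (I : {set 'I_N})
    (omega C : R) : Prop :=
  [/\ (forall i, periodic_on base3_dom (tgC i)
                 /\ C1_norm_le base3_dom (tgC i) (C * eps)),
      periodic_on base3_dom tgI /\ C1_norm_le base3_dom tgI (C * eps) &
      exists X : state R N -> state R N,
      [/\ (forall s a b c v w, domain s -> X (s + state_period R a b c v w) = X s),
          (forall s, domain s ->
             (forall theta, (closure U `\` U) theta ->
                omega <= `|thetaM s.2 - theta|) ->
             X s = lifted_field delta beta sigma eps h A I s) &
          is_NAIM (@domain R N) X M_eps]].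

End Manifolds.

(* Main.v *)
Require Import Defs.
From HB Require Import structures.
From mathcomp Require Import all_boot all_order all_algebra.
From mathcomp Require Import perm complex.
From mathcomp Require Import all_classical all_reals all_analysis.
From mathcomp Require Import ring lra.

Set Implicit Arguments.
Unset Strict Implicit.
Unset Printing Implicit Defensive.

Import Order.TTheory GRing.Theory Num.Theory.
Import numFieldNormedType.Exports.

Local Open Scope classical_set_scope.
Local Open Scope ring_scope.

(* Each order parameter is trapped by a barrier: a function that decreases
   whenever it reaches its level, uniformly in beta, N and time.

   "+" star.  A leaf at distance mu from phi^C is pulled back at a rate of at
   least sigma mu cos(2 delta) / 4, up to an O(eps) forcing.  The hub
   contributes a mean field with the large factor beta, whose sign is known only
   when all leaves lie on the same side of phi^C.  So differences of leaves, in
   which the mean field cancels, are kept below mu / 2 at the same time.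

   "-" star.  The uncoupled theta_i do not move, hence the first two moments of
   the e^{i theta_j} stay O(rho + kappa) and z = alpha + O(rho + kappa +
   |alpha|^2).  The disc coordinate u = e^{-i delta} alpha rotates at a speed of
   order beta; averaging over this rotation, |u|^2 decays at rate
   sigma^2 sin(2 delta) / 2, whatever the small perturbation z - alpha does to
   the speed.  The Lyapunov function is |u|^2 with its averaging corrections of
   order 1 / (beta - 1). *)

(** * Barriers and solution curves *)

Section Barrier.
Context {R : realType}.

Lemma is_derive_cvg (V : normedModType R) (X : R -> V) (t : R) (d : V) :
  is_derive t 1 X d ->
  (fun h : R => h^-1 *: (X (h *: 1 + t) - X t)) @ 0^' --> d.
Proof. by move=> dX; rewrite -(@derive_val _ _ _ _ _ _ _ dX); exact: (@ex_derive _ _ _ _ _ _ _ dX). Qed.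

(** The difference quotients of [f \o X] are the images under [f] of those of [X], so continuity of
    [f] at [d] suffices. Linearity is stated as two equations so that plain coordinate functions of
    the state qualify. *)
Lemma is_derive_linear_comp (V W : normedModType R) (f : V -> W) (X : R -> V)
    (t : R) (d : V) :
  (forall u v, f (u - v) = f u - f v) -> (forall a u, f (a *: u) = a *: f u) ->
  continuous f -> is_derive t 1 X d -> is_derive t 1 (f \o X) (f d).
Proof.
move=> fB fZ cf dX.
have h : (fun h : R => h^-1 *: ((f \o X) (h *: 1 + t) - (f \o X) t))
    @ 0^' --> f d.
  rewrite (_ : (fun h : R => _) =
    f \o (fun h : R => h^-1 *: (X (h *: 1 + t) - X t))); last first.
    by apply/funext => h /=; rewrite fZ fB.
  apply: cvg_comp; last exact: (cf d).
  exact: is_derive_cvg.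
apply: DeriveDef; first by apply/cvg_ex; exists (f d).
exact: cvg_lim.
Qed.

Lemma derive_ge0_left_max (f : R -> R) (s t d : R) :
  s < t -> is_derive t 1 f d -> (forall u, s < u < t -> f u <= f t) -> 0 <= d.
Proof.
move=> st df fle; rewrite leNgt; apply/negP => d0.
have h : (fun h : R => h^-1 *: (f (h *: 1 + t) - f t)) @ 0^' --> d.
  exact: is_derive_cvg.
have /nbhs_ballP[e /= e0 he] : nbhs (0 : R)
    [set k : R | k != 0 -> k^-1 *: (f (k *: 1 + t) - f t) < 0].
  exact: cvgr_lt h 0 d0.
(* A negative increment that stays both in the ball where the quotient is negative and to the right
   of [s]; there the numerator is nonpositive, so the quotient cannot be negative. *)
pose k := - (Num.min (e / 2) ((t - s) / 2)).
have m0 : 0 < - k by rewrite opprK lt_min; apply/andP; split; lra.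
have me : - k <= e / 2 by rewrite opprK ge_min lexx.
have ms : - k <= (t - s) / 2 by rewrite opprK ge_min lexx orbT.
have k0 : k != 0 by rewrite lt_eqF //; lra.
have /(he k)/(_ k0) : ball 0 e k.
  by rewrite /ball /= sub0r normrN ltr0_norm; lra.
rewrite -[k *: 1]/(k * 1) mulr1 => hk.
have hf : f (k + t) <= f t by apply: fle; lra.
have : 0 <= k^-1 * (f (k + t) - f t).
  by apply: mulr_le0; rewrite ?invr_le0; lra.
by rewrite leNgt; apply/negP; rewrite negbK.
Qed.

(** First-exit argument: at the infimum [s] of the bad times all barriers hold weakly and one is
    attained from below, which forces a nonnegative derivative. The barriers are treated jointly,
    since the sign of one derivative may depend on the other bounds. Finiteness of [J] lets strict
    inequalities at one time persist nearby for all [j] at once. *)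
Lemma barrier (J : finType) (T : R) (F : J -> R -> R) (v : J -> R) :
  (forall j, {within `[0, T[, continuous (F j)}) ->
  (forall j, F j 0 < v j) ->
  (forall t j, 0 < t < T -> (forall i, F i t <= v i) -> F j t = v j ->
     exists2 d, is_derive t 1 (F j) d & d < 0) ->
  forall t j, 0 <= t < T -> F j t < v j.
Proof.
move=> cF F0 dF t0 j0 t0T; rewrite ltNge; apply/negP => bad0.
have cF' j s : 0 <= s < T -> F j x @[x --> within `[0, T[ (nbhs s)] --> F j s.
  move=> hs; have /subspace_continuousP := cF j; apply.
  by rewrite /= in_itv.
pose E := [set t | 0 <= t <= t0 /\ exists j, v j <= F j t].
have E0 : E t0 by split; [lra | exists j0].
have lE : lbound E 0 by move=> t [/andP[]].
have iE : has_inf E by split; [exists t0 | exists 0].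
set s := inf E.
have s0 : 0 <= s by apply: lb_le_inf => //; exists t0.
have st0 : s <= t0 by apply: ge_inf => //; exists 0.
have sT : 0 <= s < T by lra.
have below t j : 0 <= t < s -> F j t < v j.
  move=> /andP[t1 t2]; rewrite ltNge; apply/negP => hj.
  have : E t by split; [lra | exists j].
  by move=> /(ge_inf (ex_intro _ 0 lE)); rewrite -/s; lra.
have le_s j : F j s <= v j.
  rewrite leNgt; apply/negP => hj.
  have sN0 : 0 < s by rewrite lt_neqAle s0 andbT; apply/eqP => s0'; move: hj;
    rewrite -s0' => hj; have := F0 j; lra.
  have /nbhs_ballP[e /= e0 he] : nbhs s
      [set x : R | `[0, T[%classic x -> v j < F j x].
    exact: cvgr_gt (cF' j s sT) _ hj.
  (* If the level were exceeded at [s], continuity would make it exceeded at this earlier time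
     already. *)
  pose u := Num.max 0 (s - e / 2).
  have u0 : 0 <= u by rewrite le_max lexx.
  have u1 : s - e / 2 <= u by rewrite le_max lexx orbT.
  have us : u < s by rewrite gt_max; apply/andP; split; lra.
  have : v j < F j u.
    apply: (he u); first by rewrite /ball /= ger0_norm; lra.
    by rewrite /= in_itv /=; lra.
  by have := below u j; rewrite u0 us => /(_ isT); lra.
(* The infimum is attained: otherwise all inequalities would be strict on a neighbourhood of [s],
   which contains bad times. *)
have [j hj] : exists j, v j <= F j s.
  apply: contrapT => hno.
  have hlt j : F j s < v j.
    by rewrite ltNge; apply/negP => hj; apply: hno; exists j.
  have /nbhs_ballP[e /= e0 he] : nbhs s
      [set x : R | forall j, `[0, T[%classic x -> F j x < v j].
    apply: (@filter_forall R J (fun j x => `[0, T[%classic x -> F j x < v j)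
      (nbhs s) (@nbhs_filter R s)).
    by move=> j; exact: cvgr_lt (cF' j s sT) _ (hlt j).
  have [x [xt0 [j xj]] xe] := inf_adherent e0 iE.
  have sx : s <= x by apply: ge_inf; [exists 0 | split=> //; exists j].
  have : F j x < v j.
    apply: (he x); first by rewrite /ball /= ler0_norm; rewrite -/s in xe; lra.
    by rewrite /= in_itv /=; lra.
  lra.
have sN0 : 0 < s by rewrite lt_neqAle s0 andbT; apply/eqP => s0'; move: hj;
  rewrite -s0' => hj; have := F0 j; lra.
have Fjs : F j s = v j by apply/eqP; rewrite eq_le le_s.
have sT' : 0 < s < T by lra.
have [d dFj d0] := dF s j sT' le_s Fjs.
suff : 0 <= d by lra.
apply: (derive_ge0_left_max sN0 dFj) => u /andP[u0 us].
by rewrite Fjs ltW // below // ltW.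
Qed.

Lemma zero_derive_constant (T : R) (f : R -> R) :
  {within `[0, T[, continuous f} -> (forall t, 0 < t < T -> is_derive t 1 f 0) ->
  forall t, 0 <= t < T -> f t = f 0.
Proof.
move=> cf df t tT; have [t0 tT'] := andP tT.
have := @MVT_segment R f (fun=> 0) 0 t t0.
case.
- by move=> x; rewrite in_itv /= => xt; apply: df; lra.
- apply: continuous_subspaceW cf => x /=; rewrite !in_itv /=; lra.
- by move=> c _; rewrite mul0r => /eqP; rewrite subr_eq0 => /eqP.
Qed.

(** Compactness of one period gives the bound, and [floor (x / (2 * pi))] turns bring any [x] back
    to that period. The bound makes the coupling an O(eps) forcing. *)
Lemma C1_periodic_bounded (h : R -> R) :
  (forall x, h (x + 2 * pi) = h x) -> C1_on setT h ->
  exists2 H : R, 0 < H & forall x, `|h x| <= H.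
Proof.
move=> hper hC1.
have hn x n : h (x + 2 * pi * n%:R) = h x.
  elim: n => [|n IH]; first by rewrite mulr0 addr0.
  by rewrite -[n.+1]addn1 natrD mulrDr mulr1 addrA hper.
have hz x (m : int) : h (x + 2 * pi * m%:~R) = h x.
  case: m => n; first exact: hn.
  by rewrite NegzE -(hn (x + _) n.+1) mulrNz mulrN addrNK.
have ch : {within `[0, 2 * pi], continuous h}.
  apply: continuous_subspaceT => x.
  by apply: differentiable_continuous; have [] := hC1 x I.
have /compact_bounded[M [_ hM]] := continuous_compact ch (@segment_compact _ 0 (2 * pi)).
exists (`|M| + 1); first by rewrite ltr_pwDr.
move=> x; have p0 := pi_gt0 R.
have {1}-> : x = (x - 2 * pi * (Num.floor (x / (2 * pi)))%:~R)
    + 2 * pi * (Num.floor (x / (2 * pi)))%:~R by rewrite addrNK.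
rewrite hz; apply: (hM (`|M| + 1)); first by have := ler_norm M; lra.
have p2 : 0 < 2 * pi :> R by lra.
have f1 : (Num.floor (x / (2 * pi)))%:~R <= x / (2 * pi) := floor_le _.
have f2 : x / (2 * pi) < (Num.floor (x / (2 * pi)))%:~R + 1
    by rewrite -[1]/(1%:~R) -intrD -floor_lt_int ltzD1.
exists (x - 2 * pi * (Num.floor (x / (2 * pi)))%:~R) => //=; rewrite in_itv /=.
move: f1 f2; set k := _%:~R; rewrite ler_pdivlMr // ltr_pdivrMr //; lra.
Qed.

End Barrier.

(** * The circle and the disc *)

Section CircleAndDisc.
Context {R : realType}.
Implicit Types (s t : R) (z w alpha : R[i]).
Local Notation normc := Normc.normc.

Lemma sin_MVT s t : s <= t ->
  exists2 c : R, s <= c <= t & sin t - sin s = cos c * (t - s).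
Proof.
move=> st; have [|c] := @MVT_segment R sin cos s t st.
- by apply: continuous_subspaceT; exact: continuous_sin.
- by rewrite in_itv /= => hc ->; exists c.
Qed.

Lemma sin_lipschitz s t : `|sin s - sin t| <= `|s - t|.
Proof.
wlog st : s t / s <= t.
  move=> hw; have [st|/ltW ts] := leP s t; first exact: hw.
  by rewrite distrC (distrC s); exact: hw.
have [c _ e] := sin_MVT st.
by rewrite distrC e normrM (distrC s) ler_piMl // cos_max.
Qed.

Lemma cos_lipschitz s t : `|cos s - cos t| <= `|s - t|.
Proof.
have := sin_lipschitz (s + pi / 2) (t + pi / 2).
by rewrite !sinDpihalf opprD addrACA subrr addr0.
Qed.

Lemma normc_sqr z : normc z ^+ 2 = complex.Re z ^+ 2 + complex.Im z ^+ 2.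
Proof. by case: z => a b /=; rewrite sqr_sqrtr // addr_ge0 // sqr_ge0. Qed.

Lemma normc_ge0 z : 0 <= normc z.
Proof. by case: z => a b; exact: sqrtr_ge0. Qed.

Lemma normc_conj z : normc (conjc z) = normc z.
Proof. by case: z => a b /=; rewrite sqrrN. Qed.

Lemma normcX z n : normc (z ^+ n) = normc z ^+ n.
Proof.
by elim: n => [|n IH]; rewrite ?expr0 ?Normc.normc1 // !exprS Normc.normcM IH.
Qed.

Lemma normcD z w : normc (z + w) <= normc z + normc w.
Proof. exact: le_normcD. Qed.

Lemma normcB z w : normc (z - w) <= normc z + normc w.
Proof. by rewrite -(normcN w) normcD. Qed.

Lemma normc_le_ReIm z : normc z <= `|complex.Re z| + `|complex.Im z|.
Proof.
rewrite -(ler_pXn2r (ltn0Sn 1)) ?nnegrE ?normc_ge0 ?addr_ge0 //.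
rewrite normc_sqr sqrrD !real_normK ?num_real // lerD2r lerDl.
by rewrite mulrn_wge0 // mulr_ge0.
Qed.

Lemma Re_le_normc z : complex.Re z <= normc z.
Proof.
rewrite (le_trans (ler_norm _)) // -(ler_pXn2r (ltn0Sn 1)) ?nnegrE ?normc_ge0 //.
by rewrite normc_sqr real_normK ?num_real // lerDl sqr_ge0.
Qed.

Lemma Im_le_normc z : `|complex.Im z| <= normc z.
Proof.
rewrite -(ler_pXn2r (ltn0Sn 1)) ?nnegrE ?normc_ge0 //.
by rewrite normc_sqr real_normK ?num_real // lerDr sqr_ge0.
Qed.

Lemma expi0 : expi 0 = 1 :> R[i].
Proof. by rewrite /expi cos0 sin0. Qed.

Lemma expiD s t : expi (s + t) = expi s * expi t.
Proof. by rewrite /expi cosD sinD; congr Complex; rewrite addrC mulrC. Qed.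

Lemma expiX t n : expi t ^+ n = expi (n%:R * t).
Proof.
elim: n => [|n IH]; first by rewrite expr0 mul0r expi0.
by rewrite exprS IH -expiD mulrS mulrDl mul1r.
Qed.

Lemma normc_expi t : normc (expi t) = 1.
Proof. by rewrite /expi /= cos2Dsin2 sqrtr1. Qed.

Lemma expi_period t (m : int) : expi (t + 2 * pi * m%:~R) = expi t.
Proof.
have h (u : R) n : expi (u + 2 * pi * n%:R) = expi u.
  elim: n => [|n IH]; first by rewrite mulr0 addr0.
  rewrite -[n.+1]addn1 natrD mulrDr mulr1 addrA /expi.
  by rewrite mulr_natl cosD2pi sinD2pi -mulr_natl.
case: m => n; first exact: h.
by rewrite NegzE -(h (t + _) n.+1) mulrNz mulrN addrNK.
Qed.

(** The factor 2 comes from bounding real and imaginary parts separately. *)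
Lemma expi_lipschitz s t : normc (expi s - expi t) <= 2 * `|s - t|.
Proof.
rewrite (le_trans (normc_le_ReIm _)) // mulr_natl mulr2n.
by apply: lerD; [exact: cos_lipschitz | exact: sin_lipschitz].
Qed.

Lemma normc_sum (J : finType) (P : pred J) (f : J -> R[i]) :
  normc (\sum_(j | P j) f j) <= \sum_(j | P j) normc (f j).
Proof.
elim/big_rec2: _ => [|j x y _ h]; first by rewrite Normc.normc0.
by rewrite (le_trans (normcD _ _)) // lerD2l.
Qed.

Lemma normc_nat n : normc (n%:R : R[i]) = n%:R.
Proof. by rewrite (normcMn (1 : R[i])) Normc.normc1. Qed.

(** The Kuramoto-Daido order parameter of order [n]: a Fourier coefficient of the empirical
    distribution of the angles. *)
Definition moment (N : nat) (theta : 'rV[R]_N) (n : nat) : R[i] :=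
  N%:R^-1 * \sum_j expi (theta 0 j) ^+ n.

Lemma natc_neq0 N : (0 < N)%N -> (N%:R : R[i]) != 0.
Proof. by move=> N0; rewrite pnatr_eq0 -lt0n. Qed.

Lemma normc_mean N (f : 'I_N -> R[i]) c : (0 < N)%N ->
  \sum_j normc (f j) <= c * N%:R -> normc (N%:R^-1 * \sum_j f j) <= c.
Proof.
move=> N0 h; rewrite Normc.normcM Normc.normcV normc_nat mulrC.
by rewrite ler_pdivrMr ?ltr0n // (le_trans (normc_sum _ _)).
Qed.

Lemma sum_expi_root N (w : R[i]) : w ^+ N = 1 -> w != 1 ->
  \sum_(j < N) w ^+ j = 0.
Proof.
move=> wN w1; have := subrX1 w N; rewrite wN subrr => /esym/eqP.
by rewrite mulf_eq0 subr_eq0 (negbTE w1) => /eqP.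
Qed.

(** Up to a phase the sum is a geometric sum over powers of [w], an [N]-th root of unity. The bounds
    on [n] and [N] ensure [w != 1]; for [n = 2] this would fail at [N = 2]. *)
Lemma moment_uniform N (theta : 'rV[R]_N) n : (2 < N)%N -> (0 < n <= 2)%N ->
  uniform_states R N theta -> moment theta n = 0.
Proof.
move=> N2 n2 [phi [s [m h]]]; rewrite /moment.
have N0 : (N%:R : R) != 0 by rewrite pnatr_eq0; case: (N) N2.
have N0' : (0 : R) < N%:R by rewrite ltr0n; case: (N) N2.
have N3 : (3 : R) <= N%:R by rewrite ler_nat.
pose w : R[i] := expi (n%:R * (2 * pi / N%:R)).
have wN : w ^+ N = 1.
  rewrite /w expiX (_ : _ * _ = 0 + 2 * pi * n%:~R).
    by rewrite expi_period expi0.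
  rewrite add0r -pmulrn; field.
  by rewrite N0.
have p0 := pi_gt0 R.
have sw : 0 < sin (2 * pi / N%:R : R).
  apply: sin_gt0_pi; apply/andP; split.
    by rewrite divr_gt0 // mulr_gt0.
  by rewrite ltr_pdivrMr // mulrC ltr_pM2l //; lra.
(* With [a] the angle 2 pi / N, [w = 1] forces sin a = 0: at once for [n = 1], and through cos(2 a)
   = 1 for [n = 2]. But 0 < a < pi. *)
have w1 : w != 1.
  apply/eqP; rewrite /w; move: sw; set a := 2 * pi / _ => sw.
  case: n n2 {w wN} => [|[|[|n]]] // _.
    by rewrite mul1r => -[_ s0]; move: sw; rewrite s0 ltxx.
  rewrite -expiX => -[]; have := cos2Dsin2 a; move: sw.
  set x := cos a; set y := sin a; clearbody x y => y0 xy h1 h2.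
  suff : 0 < y ^+ 2 by nra.
  by rewrite exprn_gt0.
(* The isolated factor [w] accounts for the positions being numbered from 1, the ordinals from 0. *)
have -> : \sum_j expi (theta 0 j) ^+ n
    = expi (n%:R * phi) * w * \sum_(j < N) w ^+ j.
  rewrite [in RHS](reindex_inj (@perm_inj _ s)) mulr_sumr; apply: eq_bigr => j _.
  rewrite h expi_period /w !expiX -!expiD; congr expi.
  by rewrite -[(s j).+1]addn1 natrD; field.
by rewrite sum_expi_root // !mulr0.
Qed.

(** Leaves outside [I] are controlled by the Lipschitz bound. Those in [I] may be anywhere: each
    costs at most 2, but their proportion is at most [kappa]. *)
Lemma moment_dist N (I : {set 'I_N}) (theta theta0 : 'rV[R]_N) n (rho kappa : R) :
  (0 < N)%N -> 0 <= rho ->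
  (forall j, j \notin I -> `|theta 0 j - theta0 0 j| <= rho) ->
  #|I|%:R <= kappa * N%:R ->
  normc (moment theta n - moment theta0 n) <= 2 * n%:R * rho + 2 * kappa.
Proof.
move=> N0 rho0 h hI; rewrite /moment -mulrBr -sumrB; apply: normc_mean => //.
have b j : normc (expi (theta 0 j) ^+ n - expi (theta0 0 j) ^+ n) <= 2.
  by rewrite (le_trans (normcB _ _)) // !expiX !normc_expi.
rewrite (bigID (mem I)) /= mulrDl addrC lerD //.
  rewrite (@le_trans _ _ (\sum_(j < N) 2 * n%:R * rho)) //; last first.
    by rewrite sumr_const card_ord -[leLHS]mulr_natr.
  rewrite [leRHS](bigID (mem I)) /= ler_wpDl //.
    by rewrite sumr_ge0 // => j _; rewrite !mulr_ge0.
  apply: ler_sum => j jI; rewrite !expiX (le_trans (expi_lipschitz _ _)) //.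
  rewrite -mulrBr normrM ger0_norm // -mulrA; apply: ler_wpM2l => //.
  by apply: ler_wpM2l => //; exact: h.
rewrite (@le_trans _ _ (\sum_(j in I) 2)) //; first exact: ler_sum.
by rewrite sumr_const -[leLHS]mulr_natr -mulrA ler_wpM2l.
Qed.

(** The left side is (1 - |alpha|^2) v / (1 + q), where v = e^{i psi} w and q = conj(alpha) v. The
    quotient 1 / (1 + q) is expanded to second order with exact remainder, so that the average over
    the leaves involves two moments and an O(|alpha|^2) term. *)
Lemma mobius_expand alpha psi w : normc alpha < 1 -> normc w = 1 ->
  mobius alpha psi w - alpha = (1 - alpha * conjc alpha) *
    (expi psi * w - conjc alpha * (expi psi ^+ 2 * w ^+ 2)
     + conjc alpha ^+ 2 * (expi psi * w) ^+ 3
       / (1 + conjc alpha * expi psi * w)).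
Proof.
move=> a1 w1.
have hd : 1 + conjc alpha * expi psi * w != 0.
  apply/eqP => /eqP; rewrite addr_eq0 => /eqP /(congr1 (@Normc.normc R)).
  rewrite normcN !Normc.normcM normc_conj normc_expi w1 !mulr1 Normc.normc1 => h.
  by move: a1; rewrite -h ltxx.
rewrite /mobius; move: hd; set c := conjc alpha; set e := expi psi => hd.
by field.
Qed.

Lemma zmean_dist N alpha psi (theta : 'rV[R]_N) :
  (0 < N)%N -> normc alpha <= 2^-1 ->
  normc (zmean alpha psi theta - alpha) <=
    normc (moment theta 1) + normc (moment theta 2) + 2 * normc alpha ^+ 2.
Proof.
move=> N0 a12; have a1 : normc alpha < 1 by apply: le_lt_trans a12 _; lra.
have a0 := normc_ge0 alpha.
pose rem j : R[i] := conjc alpha ^+ 2 * (expi psi * expi (theta 0 j)) ^+ 3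
       / (1 + conjc alpha * expi psi * expi (theta 0 j)).
have -> : zmean alpha psi theta - alpha = (1 - alpha * conjc alpha) *
    (expi psi * moment theta 1 - conjc alpha * expi psi ^+ 2 * moment theta 2
     + N%:R^-1 * \sum_j rem j).
  have {2}-> : alpha = N%:R^-1 * \sum_(j < N) alpha.
    by rewrite sumr_const card_ord -[alpha *+ _]mulr_natl mulKf // natc_neq0.
  have -> : moment theta 1 = N%:R^-1 * \sum_j expi (theta 0 j).
    by congr (_ * _); apply: eq_bigr => j _; rewrite expr1.
  rewrite /zmean -mulrBr -sumrB /moment.
  rewrite (eq_bigr _ (fun j _ => mobius_expand _ a1 (normc_expi (theta 0 j)))).
  rewrite -mulr_sumr !big_split /= sumrN -!mulr_sumr.
  rewrite -/rem; ring.
have nrem : normc (N%:R^-1 * \sum_j rem j) <= 2 * normc alpha ^+ 2.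
  apply: normc_mean => //.
  rewrite (@le_trans _ _ (\sum_(j < N) 2 * normc alpha ^+ 2)) //; last first.
    by rewrite sumr_const card_ord -[leLHS]mulr_natr.
  apply: ler_sum => j _; rewrite /rem Normc.normcM Normc.normcV Normc.normcM !normcX.
  rewrite !Normc.normcM !normc_expi normc_conj !mulr1 expr1n mulr1 mulrC.
  apply: ler_wpM2r; first exact: sqr_ge0.
  (* The subtracted term has modulus [normc alpha], at most 1/2; this is the source of the factor 2
     before [normc alpha ^+ 2]. *)
  have hd : 2^-1 <= normc (1 + conjc alpha * expi psi * expi (theta 0 j)).
    have := normcB (1 + conjc alpha * expi psi * expi (theta 0 j))
      (conjc alpha * expi psi * expi (theta 0 j)).
    rewrite addrK Normc.normc1 !Normc.normcM !normc_expi normc_conj !mulr1; lra.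
  by rewrite invf_ple ?posrE //; lra.
have n1 : normc (1 - alpha * conjc alpha) <= 1.
  have -> : 1 - alpha * conjc alpha = Complex (1 - normc alpha ^+ 2) 0.
    rewrite normc_sqr; case: (alpha) => a b.
    by apply/eqP; rewrite eq_complex /=; apply/andP; split; apply/eqP; ring.
  rewrite /= expr0n addr0 sqrtr_sqr ger0_norm.
    by have := sqr_ge0 (normc alpha); lra.
  by rewrite subr_ge0 expr_le1 // ltW.
rewrite Normc.normcM (le_trans (ler_piMl (normc_ge0 _) n1)) //.
rewrite (le_trans (normcD _ _)) // lerD //.
rewrite (le_trans (normcB _ _)) // !Normc.normcM !normc_expi.
rewrite normc_conj mul1r !mulr1 lerD2l.
by rewrite ler_piMl ?mulr_ge0 ?normc_ge0 // ltW.
Qed.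

End CircleAndDisc.

(** * Bistable parameters *)

Section Bistability.
Context {R : realType} (delta : R).
Hypothesis hdelta : 0 < delta < pi / 4.
Local Notation K := (cos (2 * delta)).
Local Notation S := (sin (2 * delta)).
Local Notation normc := Normc.normc.

Lemma cos2delta_gt0 : 0 < K.
Proof. by move: hdelta => hd; apply: cos_gt0_pihalf; have := pi_gt0 R; lra. Qed.

Lemma sin2delta_gt0 : 0 < S.
Proof. by move: hdelta => hd; apply: sin_gt0_pi; have := pi_gt0 R; lra. Qed.

Lemma sigma_ge4 (sigma : R) : 4 <= sigma * K -> 4 <= sigma.
Proof.
move: cos2delta_gt0 (cos_le1 (2 * delta)); set k := K; clearbody k => k0 k1 h.
have : 0 < sigma by rewrite -(pmulr_lgt0 _ k0); lra.
nra.
Qed.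

Variables (beta sigma : R).
Hypotheses (beta_gt1 : 1 < beta) (sigma_ge : 4 <= sigma * K).
Local Notation rad := (Num.sqrt (1 + beta ^+ 2 + 2 * beta * K)).

Let K0 : 0 < K := cos2delta_gt0.
Let K1 : K <= 1 := cos_le1 _.
Let S0 : 0 < S := sin2delta_gt0.

Let rad2 : rad ^+ 2 = 1 + beta ^+ 2 + 2 * beta * K.
Proof. by move: beta_gt1 => b1; rewrite sqr_sqrtr //; have := K0; nra. Qed.

(** [rad] is the modulus of 1 + beta e^{2 i delta}, hence comparable to [beta] on both sides. *)
Let rad_ge : beta < rad.
Proof.
move: beta_gt1 => b1; rewrite -(ltr_pXn2r (ltn0Sn 1)) ?nnegrE ?sqrtr_ge0 //; last lra.
by rewrite rad2; have := K0; nra.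
Qed.

Let rad_le : rad <= 1 + beta.
Proof.
move: beta_gt1 => b1; rewrite -(ler_pXn2r (ltn0Sn 1)) ?nnegrE ?sqrtr_ge0 //; last lra.
by rewrite rad2; have := K1; nra.
Qed.

(** With x = phi - delta, the equilibrium equation is (1 + beta K) sin x + beta S cos x = - (beta -
    1) / sigma. Its left side is rad cos(x - atan T), so that x = atan T + acos q - pi solves it.
    The bound sigma K >= 4 keeps [q] below K / 4, whence sin(acos q) >= 3/4 and both cosines stay
    away from 0 uniformly in [beta]. *)
Lemma phiC_properties : let phi := phiC delta beta sigma in
  [/\ 1 + sigma * sin (delta - phi) = beta + beta * sigma * sin (phi + delta),
      K / 2 <= cos (phi - delta) & 4^-1 <= cos (phi + delta)].
Proof.
move=> phi; move: beta_gt1 sigma_ge => b1 sK.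
have s4 := sigma_ge4 sK.
have r0 : 0 < rad by apply: lt_trans rad_ge; lra.
have b0 : 0 < beta * S by rewrite mulr_gt0 //; lra.
pose T := (1 + beta * K) / (beta * S).
pose q := (beta - 1) / (sigma * rad).
have q0 : 0 <= q by rewrite divr_ge0 //; [lra | rewrite mulr_ge0 //; lra].
have qK : q <= K / 4.
  have -> : q = (beta - 1) / rad / sigma by rewrite /q invfM mulrA mulrAC.
  rewrite ler_pdivrMr; last lra.
  rewrite (@le_trans _ _ 1) //; last by lra.
    by rewrite ler_pdivrMr // mul1r; have := rad_ge; lra.
have q1 : -1 <= q <= 1 by have := K1; lra.
(* Names for the sines and cosines, so that only polynomial relations between them remain. *)
have [] : exists a b d, [/\ cos (atan T) = a, sin (atan T) = b,
    cos (acos q) = q, sin (acos q) = d & [/\ a * rad = beta * S,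
    b * rad = 1 + beta * K, d ^+ 2 = 1 - q ^+ 2, 0 <= d & a ^+ 2 + b ^+ 2 = 1]].
  exists (cos (atan T)), (sin (atan T)), (sin (acos q)).
  have ca : cos (atan T) * rad = beta * S.
    (* The legs beta S and 1 + beta K have hypotenuse [rad], because K^2 + S^2 = 1. *)
    have h : (Num.sqrt (1 + T ^+ 2)) * (beta * S) = rad.
      apply/eqP; rewrite -(eqrXn2 (ltn0Sn 1)) ?mulr_ge0 ?sqrtr_ge0 ?(ltW b0) //.
      - rewrite exprMn rad2 sqr_sqrtr ?addr_ge0 ?sqr_ge0 // mulrDl mul1r.
        rewrite -[T ^+ 2 * _]exprMn divfK ?(gt_eqF b0) // exprMn sin2cos2.
        by apply/eqP; ring.
      - lra.
      - by move: S0; lra.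
    rewrite cos_atan -h mulKf // gt_eqF // sqrtr_gt0.
    by have := sqr_ge0 T; lra.
  have c0 : cos (atan T) != 0.
    by apply/eqP => c0; move: ca; rewrite c0 mul0r => b0'; move: b0; rewrite -b0' ltxx.
  split=> //.
    by rewrite acosK // in_itv.
  split=> //.
  - have <- : T * cos (atan T) = sin (atan T).
      by rewrite -{1}[T](atanK T) /tan divfK.
    by rewrite -mulrA ca /T divfK // gt_eqF.
  - by rewrite sin2cos2 acosK // in_itv.
  - by apply: sin_ge0_pi; rewrite acos_ge0 // acos_lepi.
  - exact: cos2Dsin2.
move=> a [b [d [ea eb ec ed [ha hb hd d0 ab]]]].
have cs : cos (phi - delta) = b * d - a * q.
  have -> : phi - delta = atan T + acos q - pi by rewrite /phi /phiC -/T -/q; ring.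
  rewrite -[LHS]opprK -cosDpi addrNK cosD ea eb ec ed; ring.
have sn : sin (phi - delta) = - (b * q + a * d).
  have -> : phi - delta = atan T + acos q - pi by rewrite /phi /phiC -/T -/q; ring.
  rewrite -[LHS]opprK -sinDpi addrNK sinD ea eb ec ed; ring.
have sp : sin (phi + delta) = sin (phi - delta) * K + cos (phi - delta) * S.
  by rewrite -sinD; congr sin; ring.
have cp : cos (phi + delta) = cos (phi - delta) * K - sin (phi - delta) * S.
  by rewrite -cosD; congr cos; ring.
have hq : q * (sigma * rad) = beta - 1.
  by rewrite /q divfK // mulf_neq0 // gt_eqF //; lra.
have KS : K ^+ 2 + S ^+ 2 = 1 := cos2Dsin2 _.
have d34 : 3 / 4 <= d.
  rewrite leNgt; apply/negP => dl.
  have : q <= 4^-1 by have := K1; lra.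
  by nra.
have bK : K <= b.
  rewrite -(ler_pM2r r0) hb.
  have := rad_le; have := K0; have := K1; nra.
have a0 : 0 <= a by rewrite -(pmulr_lge0 _ r0) ha ltW.
have a1 : a <= 1 by nra.
split.
- rewrite -opprB sinN sp cs sn.
  suff : sigma * ((b * rad) * (b * q + a * d) - (a * rad) * (b * d - a * q))
      = beta - 1 by rewrite ha hb; lra.
  transitivity (q * (sigma * rad) * (a ^+ 2 + b ^+ 2)); first by ring.
  by rewrite ab mulr1.
- rewrite cs; have : a * q <= q by rewrite ler_piMl.
  have : K * (3 / 4) <= b * d by apply: ler_pM => //; have := K0; lra.
  lra.
- have e1 : cos (phi + delta) * rad = d * (K + beta) + q * S.
    rewrite cp cs sn.
    transitivity (d * ((b * rad) * K + (a * rad) * S)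
      + q * ((b * rad) * S - (a * rad) * K)); first by ring.
    rewrite ha hb.
    transitivity (d * (K + beta * (K ^+ 2 + S ^+ 2)) + q * S); first by ring.
    by rewrite KS mulr1.
  rewrite -(ler_pM2r r0) e1.
  have : 0 <= q * S by rewrite mulr_ge0 // ltW.
  have : 3 / 4 * beta <= d * (K + beta) by apply: ler_pM => //; have := K0; lra.
  have := rad_le; lra.
Qed.

(** The threshold on [beta] depends only on the upper bound [s] of [sigma]. The discriminant
    condition holds because its left side is linear in [beta] and its right side quadratic. *)
Lemma bistable_large s : sigma <= s -> 4 * s ^+ 2 < beta - 1 ->
  bistable delta beta sigma.
Proof.
move=> hs hb; move: beta_gt1 sigma_ge => b1 sK; have s4 := sigma_ge4 sK; have [_ c1 c2] := phiC_properties.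
have k0 := K0; have k1 := K1.
split=> //; try lra.
- have r0 := rad_ge.
  rewrite (lt_le_trans (_ : _ < rad)) //; first by lra.
  by rewrite ler_peMl //; lra.
- have h1 : sigma ^+ 2 <= s ^+ 2 by rewrite ler_pXn2r ?nnegrE //; lra.
  have h2 : sigma ^+ 2 * (1 + 2 * beta * K) <= s ^+ 2 * (1 + 2 * beta).
    by apply: ler_pM; rewrite ?sqr_ge0 //; nra.
  have s16 : 16 <= s ^+ 2 by nra.
  nra.
- have : 0 <= beta * (cos (phiC delta beta sigma + delta) - 4^-1).
    by rewrite mulr_ge0 //; lra.
  lra.
Qed.

(** With [w] the square root of the discriminant, sigma^2 c = (beta - 1 - w)(beta - 1 + w), so the
    modulus equals sigma / (beta - 1 + w). The incoherent equilibrium is thus O(1 / beta). *)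
Lemma normc_alphaI : sigma ^+ 2 * (1 + 2 * beta * K) < (beta - 1) ^+ 2 ->
  normc (alphaI delta beta sigma) <= sigma / (beta - 1).
Proof.
move=> hX; move: beta_gt1 sigma_ge => b1 sK; have s4 := sigma_ge4 sK; have k0 := K0.
rewrite /alphaI Normc.normcM normc_expi mulr1 /= expr0n addr0 sqrtr_sqr.
set c := 1 + 2 * beta * K; rewrite -/c in hX.
have c0 : 0 < c by rewrite /c; nra.
set w := Num.sqrt _.
have w0 : 0 <= w := sqrtr_ge0 _.
have w2 : w ^+ 2 = (beta - 1) ^+ 2 - sigma ^+ 2 * c by rewrite sqr_sqrtr // subr_ge0 ltW.
have sc0 : 0 < sigma * c by rewrite mulr_gt0 //; lra.
have b0 : 0 < beta - 1 by lra.
have w1 : w <= beta - 1.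
  rewrite -(ler_pXn2r (ltn0Sn 1)) ?nnegrE ?w2 //; last lra.
  by have : 0 <= sigma * (sigma * c) by [rewrite mulr_ge0 //; lra]; lra.
rewrite ger0_norm; last by rewrite divr_ge0 //; lra.
rewrite ler_pdivrMr // mulrAC ler_pdivlMr //.
nra.
Qed.

End Bistability.

(** * The coherent star *)

Section CoherentStar.
Context {R : realType}.

Lemma sin_slope (x y m : R) : x <= y -> (forall z, x <= z <= y -> m <= cos z) ->
  m * (y - x) <= sin y - sin x.
Proof.
move=> xy h; have [c hc ->] := sin_MVT xy.
by apply: ler_wpM2r; [rewrite subr_ge0 | exact: h].
Qed.

Lemma cos_near (z z0 mu : R) : `|z - z0| <= mu -> cos z0 - mu <= cos z.
Proof.
move=> h; have := le_trans (cos_lipschitz z z0) h; rewrite ler_norml.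
by move=> /andP[]; lra.
Qed.

(** When a leaf touches phi0 + mu, the bound mu / 2 on differences puts all leaves above phi0. The
    mean field is then at least its equilibrium value and pushes back, however large [beta] is. The
    remaining rate is at most - mu + e; for a difference it is at most - mu / 2 + 2 e, which is
    where [4 * e < mu] enters. *)
Lemma coherent_star (N : nat) (T delta beta sigma phi0 K mu e : R)
    (phi : 'I_N -> R -> R) :
  (0 < N)%N -> 0 < mu -> 0 <= beta -> 0 < K -> 4 <= sigma * K ->
  mu <= K / 4 -> mu <= 4^-1 -> 4 * e < mu ->
  1 + sigma * sin (delta - phi0) = beta + beta * sigma * sin (phi0 + delta) ->
  K / 2 <= cos (phi0 - delta) -> 4^-1 <= cos (phi0 + delta) ->
  (forall i, {within `[0, T[, continuous (phi i)}) ->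
  (forall i, `|phi i 0 - phi0| < mu / 4) ->
  (forall i t, 0 < t < T -> exists2 p, `|p| <= e &
     is_derive t 1 (phi i) (1 + sigma * sin (delta - phi i t) + p
       - (beta + beta * (sigma / N%:R) * \sum_j sin (phi j t + delta)))) ->
  forall i t, 0 <= t < T -> `|phi i t - phi0| < mu.
Proof.
move=> N0 mu0 b0 K0 sK muK mu4 e_mu eqphi cm cp cphi phi_init dphi.
have NR : (N%:R : R) != 0 by rewrite pnatr_eq0 -lt0n.
have s0 : 0 < sigma by rewrite -(pmulr_lgt0 _ K0); lra.
(* Three families of barriers: differences of leaves, upper bounds, and lower bounds written as
   upper bounds for [- phi i]. *)
pose J : finType := (('I_N * 'I_N) + ('I_N + 'I_N))%type.
pose F (j : J) : R -> R := match j with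
  | inl (i, k) => fun t => phi i t - phi k t
  | inr (inl i) => phi i | inr (inr i) => fun t => - phi i t
  end.
pose v (j : J) : R := match j with
  | inl _ => mu / 2 | inr (inl i) => phi0 + mu | inr (inr i) => mu - phi0 end.
have init i : phi0 - mu / 4 < phi i 0 < phi0 + mu / 4.
  by have := phi_init i; rewrite ltr_norml => /andP[]; lra.
(* Within [mu] of phi0 the cosine is at least K / 2 - mu >= K / 4, and sigma K / 4 >= 1. *)
have contract x y : x <= y -> phi0 - mu <= x -> y <= phi0 + mu ->
    sigma * (sin (delta - y) - sin (delta - x)) <= - (y - x).
  move=> xy x0 y0.
  have h : K / 4 * ((delta - x) - (delta - y)) <= sin (delta - x) - sin (delta - y).
    apply: sin_slope; first by lra.
    move=> z hz; have : `|z - (delta - phi0)| <= mu by rewrite ler_norml; lra.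
    by move=> /cos_near; rewrite -cosN opprB; lra.
  have : sigma * (K / 4 * (y - x)) <= sigma * (sin (delta - x) - sin (delta - y)).
    by rewrite ler_pM2l //; lra.
  have : 0 <= (sigma * K - 4) * (y - x) by rewrite mulr_ge0; lra.
  lra.
(* Here the cosine is at least 1/4 - mu >= 0, so the mean field increases with each leaf. *)
have mono x y : x <= y -> phi0 - mu <= x -> y <= phi0 + mu ->
    sin (x + delta) <= sin (y + delta).
  move=> xy x0 y0; rewrite -subr_ge0.
  rewrite (le_trans _ (@sin_slope (x + delta) (y + delta) 0 _ _)) //.
  - by rewrite mul0r.
  - by lra.
  - move=> z hz; have : `|z - (phi0 + delta)| <= mu by rewrite ler_norml; lra.
    by move=> /cos_near; lra.
have main t j : 0 <= t < T -> F j t < v j.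
  apply: barrier t j.
  - move=> [[i k]|[i|i]] /=; last 2 first.
    + exact: cphi.
    + by move=> x; apply: cvgN; exact: cphi.
    + by move=> x; apply: cvgB; exact: cphi.
  - move=> [[i k]|[i|i]] /=.
    + by have := init i; have := init k; lra.
    + by have := init i; lra.
    + by have := init i; lra.
  - move=> t j tT hle hj.
    have up i : phi i t <= phi0 + mu := hle (inr (inl i)).
    have lo i : phi0 - mu <= phi i t.
      by have := hle (inr (inr i)); rewrite /F /v /=; lra.
    have pr i k : phi i t - phi k t <= mu / 2 := hle (inl (i, k)).
    have [p hp dp] : exists2 p : 'I_N -> R, (forall i, `|p i| <= e) &
        (forall i, is_derive t 1 (phi i) (1 + sigma * sin (delta - phi i t) + p i
       - (beta + beta * (sigma / N%:R) * \sum_j sin (phi j t + delta)))).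
      have /choice[p hp] : forall i, exists p, `|p| <= e /\
          is_derive t 1 (phi i) (1 + sigma * sin (delta - phi i t) + p
       - (beta + beta * (sigma / N%:R) * \sum_j sin (phi j t + delta))).
        by move=> i; have [p] := dphi i t tT; exists p.
      by exists p => i; have [] := hp i.
    have hp' i : - e <= p i <= e by rewrite -ler_norml.
    set m := \sum_j _ in dp.
    have bs : 0 <= beta * (sigma / N%:R).
      by rewrite mulr_ge0 // divr_ge0 // ltW.
    have mN x : beta * (sigma / N%:R) * (\sum_(j < N) x) = beta * sigma * x.
      by rewrite sumr_const card_ord -[x *+ N]mulr_natr; field.
    case: j hj => [[i k]|[i|i]] /= hj.
    + eexists; first exact: (is_deriveB (dp i) (dp k)).
      have := contract (phi k t) (phi i t); have := up i; have := lo k.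
      have := hp' i; have := hp' k; move: hj; lra.
    + exists (1 + sigma * sin (delta - phi i t) + p i
       - (beta + beta * (sigma / N%:R) * m)) => //.
      have : beta * (sigma / N%:R) * (\sum_(j < N) sin (phi0 + delta))
          <= beta * (sigma / N%:R) * m.
        apply: ler_wpM2l => //; apply: ler_sum => j _; apply: mono => //; last lra.
        by have := pr i j; lra.
      rewrite mN; have := contract phi0 (phi i t); have := up i.
      by have := hp' i; move: eqphi; lra.
    + eexists; first exact: (is_deriveN (dp i)).
      have : beta * (sigma / N%:R) * m <=
          beta * (sigma / N%:R) * (\sum_(j < N) sin (phi0 + delta)).
        apply: ler_wpM2l => //; apply: ler_sum => j _; apply: mono => //; last lra.
        by have := pr j i; move: hj; lra.
      rewrite mN; have := contract (phi i t) phi0; have := lo i.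
      by have := hp' i; move: eqphi hj; lra.
move=> i t tT; rewrite ltr_norml; apply/andP; split.
  by have := main t (inr (inr i)) tT; rewrite /F /v /=; lra.
by have := main t (inr (inl i)) tT; rewrite /F /v /=; lra.
Qed.

End CoherentStar.

(** * The incoherent star *)

Section IncoherentStar.
Context {R : realType}.
Implicit Types (x y n S K : R).

(* [c0 * y] cancels the term [sigma x] in the derivative of [x^2 + y^2];
   [c1 * (x * y)] and [c2 * (y * y)] replace the resonant part of
   [x (x S + y K)] by its mean [S (x^2 + y^2) / 2]. *)
Definition lyapunov (e c0 c1 c2 x y : R) : R :=
  x * x + y * y + e * (c0 * y + (c1 * (x * y) + c2 * (y * y))).

Lemma normM_le (a b A B : R) : `|a| <= A -> `|b| <= B -> `|a * b| <= A * B.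
Proof. by move=> ha hb; rewrite normrM; apply: ler_pM. Qed.

(** All corrections carry the factor [e], and their coefficients are at most of order w^2 on the
    unit disc. *)
Lemma lyapunov_dist x y n S K sigma w e :
  x ^+ 2 + y ^+ 2 = n ^+ 2 -> 0 <= n <= 1 -> 0 <= S <= 1 -> 0 <= K <= 1 ->
  4 <= sigma <= w -> 0 <= e <= 1 ->
  `|lyapunov e sigma (- (sigma ^+ 2 * (1 + e) * S / 2))
      (- (sigma ^+ 2 * (1 + e) * K / 2)) x y - n ^+ 2| <= 3 * w ^+ 2 * e.
Proof.
move=> nE n01 S01 K01 sw e01.
rewrite -nE /lyapunov.
have n2 : n ^+ 2 <= 1 by nra.
have b12 : 0 <= (1 + e) / 2 <= 1 by lra.
have hxy : `|x * y| <= 2^-1.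
  have := sqr_ge0 (x - y); have := sqr_ge0 (x + y); rewrite !sqrrB !sqrrD => ? ?.
  by rewrite ler_norml; apply/andP; split; nra.
have hy2 : 0 <= y * y <= 1 by have := sqr_ge0 x; have := sqr_ge0 y; nra.
have hy : `|y| <= 1 by rewrite -(ler_pXn2r (ltn0Sn 1)) ?nnegrE // real_normK ?num_real //; nra.
have s2 : 0 <= sigma ^+ 2 <= w ^+ 2.
  by rewrite sqr_ge0 ler_pXn2r ?nnegrE //; lra.
have -> : x * x + y * y + e * (sigma * y + (- (sigma ^+ 2 * (1 + e) * S / 2) * (x * y)
    + - (sigma ^+ 2 * (1 + e) * K / 2) * (y * y))) - (x ^+ 2 + y ^+ 2)
  = e * (sigma * y - (sigma ^+ 2 * (((1 + e) / 2) * (S * (x * y)))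
     + sigma ^+ 2 * (((1 + e) / 2) * (K * (y * y))))) by field.
rewrite mulrC; apply: normM_le; last by rewrite ger0_norm; lra.
have t1 : `|sigma * y| <= w * 1 by apply: normM_le => //; rewrite ger0_norm; lra.
have t2 : `|sigma ^+ 2 * (((1 + e) / 2) * (S * (x * y)))| <= w ^+ 2 * (1 * (1 * 2^-1)).
  by do !(apply: normM_le); rewrite // ger0_norm; lra.
have t3 : `|sigma ^+ 2 * (((1 + e) / 2) * (K * (y * y)))| <= w ^+ 2 * (1 * (1 * 1)).
  apply: normM_le; first by rewrite ger0_norm; lra.
  apply: normM_le; first by rewrite ger0_norm; lra.
  by apply: normM_le; rewrite ger0_norm; lra.
rewrite (le_trans (ler_normB _ _)) //.
have := ler_normD (sigma ^+ 2 * (((1 + e) / 2) * (S * (x * y))))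
   (sigma ^+ 2 * (((1 + e) / 2) * (K * (y * y)))).
have : w <= w ^+ 2 by nra.
by lra.
Qed.

(** The six summands are, in order, the bounds [t1] to [t6] on the error terms in
    [lyapunov_rate_neg]. Since [w >= 4], all powers of [w] can be absorbed into w^3. *)
Lemma lyapunov_rate_bound n w e p :
  0 < n <= 2^-1 -> 0 < n ^+ 2 -> n ^+ 2 <= n / 2 -> 4 <= w -> 0 <= e <= 1 -> 0 <= p ->
  w * n * n ^+ 2 + w ^+ 2 * 2 * n * (p + 2 * n ^+ 2)
  + w ^+ 3 * 4 * (2 * n + (p + 2 * n ^+ 2)) * (2 * n ^+ 2)
  + e * w ^+ 2 * n ^+ 2 + e * (w ^+ 3 * 2 * 1 / 4) * n * 2
  + e * w ^+ 3 * 2 * 1 * n * n ^+ 2 <= 32 * w ^+ 3 * (n ^+ 2 + p + e) * n.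
Proof.
move=> n01 n2 n21 w4 e01 p0.
have w2 : w ^+ 2 * 2 <= w ^+ 3 by rewrite [w ^+ 3]exprS; nra.
have w1 : w <= w ^+ 3 by move: w2 w4; clear; nra.
have ww : 0 <= w ^+ 2 := sqr_ge0 w.
set B := w ^+ 2 in w2 ww *; set A := w ^+ 3 in w2 w1 *.
have A0 : 0 < A by lra.
clearbody A B.
have AN0 : 0 <= A * n by rewrite mulr_ge0 ?ltW //; lra.
have n0 : 0 <= n by lra.
have nn2 : n * n ^+ 2 <= n ^+ 2 / 2.
  by have := ler_wpM2l (ltW n2) (proj2 (andP n01)); rewrite [n * _]mulrC.
have u1 : w * n * n ^+ 2 <= A * n * n ^+ 2.
  by apply: ler_wpM2r; [exact: ltW | apply: ler_wpM2r].
have u2 : B * 2 * n * (p + 2 * n ^+ 2) <= A * n * (p + 2 * n ^+ 2).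
  by apply: ler_wpM2r; [lra | apply: ler_wpM2r => //; lra].
have u3 : A * 4 * (2 * n + (p + 2 * n ^+ 2)) * (2 * n ^+ 2)
    <= A * n * (24 * n ^+ 2 + 4 * p).
  have -> : A * 4 * (2 * n + (p + 2 * n ^+ 2)) * (2 * n ^+ 2)
    = A * n * (16 * n ^+ 2 + 8 * (p * n) + 16 * (n * n ^+ 2)) by ring.
  apply: ler_wpM2l => //.
  have : p * n <= p * 2^-1 by apply: ler_wpM2l => //; lra.
  by move: nn2; clear; lra.
have u4 : e * B * n ^+ 2 <= A * n * e.
  have -> : e * B * n ^+ 2 = B * n * (n * e) by ring.
  apply: ler_pM; rewrite ?mulr_ge0 //; try lra.
    by apply: ler_wpM2r => //; lra.
  by rewrite ler_piMl; lra.
have u5 : e * (A * 2 * 1 / 4) * n * 2 = A * n * e by field.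
have u6 : e * A * 2 * 1 * n * n ^+ 2 <= A * n * (2 * e).
  have -> : e * A * 2 * 1 * n * n ^+ 2 = A * n * (2 * (n ^+ 2 * e)) by ring.
  apply: ler_wpM2l => //; rewrite ler_pM2l //.
  by rewrite ler_piMl; lra.
have r1 : 0 <= A * n * n ^+ 2 by rewrite mulr_ge0 // ltW.
have r2 : 0 <= A * n * p by rewrite mulr_ge0.
have r3 : 0 <= A * n * e by rewrite mulr_ge0 //; lra.
rewrite u5; move: u1 u2 u3 u4 u6 r1 r2 r3; clear; lra.
Qed.

(** The first term is the averaged damping, at most - 8 S n^2 because sigma >= 4 and b >= 1. The
    others are estimated in absolute value and sum to less than that by the last hypothesis. *)
Lemma lyapunov_rate_neg x y n S K sigma w e p zeta :
  let b := 1 + e in let s := x * S + y * K + zeta in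
  x ^+ 2 + y ^+ 2 = n ^+ 2 -> 0 < n <= 2^-1 -> 0 <= S <= 1 -> 0 <= K <= 1 ->
  4 <= sigma <= w -> 0 <= e <= 1 -> 0 <= p -> `|zeta| <= p + 2 * n ^+ 2 ->
  32 * w ^+ 3 * (n ^+ 2 + p + e) < 8 * S * n ->
  - (sigma ^+ 2 * b * S / 2) * n ^+ 2 - sigma * x * n ^+ 2
  - sigma ^+ 2 * b * x * zeta
  + sigma ^+ 3 * b ^+ 2 * s * (S / 2 * (x ^+ 2 - y ^+ 2) + K * (x * y))
  - e * sigma ^+ 2 * (x * y)
  - e * (sigma ^+ 3 * b * S / 4) * y * (1 - 3 * x ^+ 2 + y ^+ 2)
  + e * sigma ^+ 3 * b * K * x * y ^+ 2 < 0.
Proof.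
move=> b s nE n01 S01 K01 sw e01 p0 hz hL.
have n2 : 0 < n ^+ 2 by rewrite exprn_gt0 //; lra.
have n21 : n ^+ 2 <= n / 2 by nra.
have hx2 : 0 <= x ^+ 2 <= n ^+ 2 by rewrite -nE; have := sqr_ge0 x; have := sqr_ge0 y; lra.
have hy2 : 0 <= y ^+ 2 <= n ^+ 2 by rewrite -nE; have := sqr_ge0 x; have := sqr_ge0 y; lra.
have hx : `|x| <= n.
  by rewrite -(ler_pXn2r (ltn0Sn 1)) ?nnegrE // ?real_normK ?num_real //; lra.
have hy : `|y| <= n.
  by rewrite -(ler_pXn2r (ltn0Sn 1)) ?nnegrE // ?real_normK ?num_real //; lra.
have hxy : `|x * y| <= n ^+ 2 by rewrite expr2; apply: normM_le.
have hxy2 : `|x ^+ 2 - y ^+ 2| <= n ^+ 2 by rewrite ler_norml; lra.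
have hxy3 : `|1 - 3 * x ^+ 2 + y ^+ 2| <= 2.
  by rewrite ler_norml; move: hx2 hy2 n21 n01; clear; lra.
have b12 : 1 <= b <= 2 by rewrite /b; lra.
have nS : `|S| <= 1 by case/andP: S01 => S0 S1; rewrite ger0_norm.
have nK : `|K| <= 1 by case/andP: K01 => K0 K1; rewrite ger0_norm.
have w4 : 4 <= w by case/andP: sw; exact: le_trans.
have w0 : 0 <= w by exact: le_trans w4.
have ns : `|sigma| <= w.
  by case/andP: sw => s4 sw1; rewrite ger0_norm //; exact: le_trans s4.
have nb : `|b| <= 2.
  by case/andP: b12 => b1 b2; rewrite ger0_norm //; exact: le_trans b1.
have ne : `|e| <= e by case/andP: e01 => e0 _; rewrite ger0_norm.
have ns2 : `|sigma ^+ 2| <= w ^+ 2 by rewrite normrX ler_pXn2r ?nnegrE.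
have ns3 : `|sigma ^+ 3| <= w ^+ 3 by rewrite normrX ler_pXn2r ?nnegrE.
have nb2 : `|b ^+ 2| <= 4.
  by rewrite (_ : 4 = 2 ^+ 2) ?normrX ?ler_pXn2r ?nnegrE //; ring.
have hs : `|s| <= 2 * n + (p + 2 * n ^+ 2).
  rewrite /s (le_trans (ler_normD _ _)) // lerD //.
  rewrite (le_trans (ler_normD _ _)) // mulr_natl mulr2n lerD //.
    by rewrite -[leRHS]mulr1; apply: normM_le.
  by rewrite -[leRHS]mulr1; apply: normM_le.
have hQ : `|S / 2 * (x ^+ 2 - y ^+ 2) + K * (x * y)| <= 2 * n ^+ 2.
  rewrite (le_trans (ler_normD _ _)) //.
  rewrite (_ : 2 * n ^+ 2 = n ^+ 2 + n ^+ 2); last by ring.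
  apply: lerD.
    rewrite -[leRHS]mul1r; apply: normM_le => //.
    by rewrite ger0_norm; move: S01; clear; lra.
  by rewrite -[leRHS]mul1r; apply: normM_le.
have t1 : `|sigma * x * n ^+ 2| <= w * n * n ^+ 2.
  have hn : `|n ^+ 2| <= n ^+ 2 by rewrite ger0_norm // ltW.
  by do 2?(apply: normM_le => //).
have t2 : `|sigma ^+ 2 * b * x * zeta| <= w ^+ 2 * 2 * n * (p + 2 * n ^+ 2).
  by do 3?(apply: normM_le => //).
have t3 : `|sigma ^+ 3 * b ^+ 2 * s * (S / 2 * (x ^+ 2 - y ^+ 2) + K * (x * y))|
   <= w ^+ 3 * 4 * (2 * n + (p + 2 * n ^+ 2)) * (2 * n ^+ 2).
  by do 3?(apply: normM_le => //).
have t4 : `|e * sigma ^+ 2 * (x * y)| <= e * w ^+ 2 * n ^+ 2.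
  by do 3?(apply: normM_le => //).
have t5 : `|e * (sigma ^+ 3 * b * S / 4) * y * (1 - 3 * x ^+ 2 + y ^+ 2)| <=
    e * (w ^+ 3 * 2 * 1 / 4) * n * 2.
  apply: normM_le => //; apply: normM_le => //; apply: normM_le => //.
  apply: normM_le; last by rewrite ger0_norm //; clear; lra.
  by apply: normM_le => //; apply: normM_le.
have t6 : `|e * sigma ^+ 3 * b * K * x * y ^+ 2| <= e * w ^+ 3 * 2 * 1 * n * n ^+ 2.
  have hny : `|y ^+ 2| <= n ^+ 2 by case/andP: hy2 => y20 y2n; rewrite ger0_norm.
  by do 5?(apply: normM_le => //).
have t0 : 8 * S * n ^+ 2 <= sigma ^+ 2 * b * S / 2 * n ^+ 2.
  rewrite ler_pM2r //; move: sw b12 S01; clear => sw b12 S01.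
  have s16 : 4 * 4 <= sigma ^+ 2 by rewrite expr2 ler_pM //; lra.
  have : 16 * S <= sigma ^+ 2 * (b * S).
    by apply: ler_pM; rewrite ?ler_peMl //; lra.
  by lra.
have hW : 32 * w ^+ 3 * (n ^+ 2 + p + e) * n < 8 * S * n ^+ 2.
  by rewrite expr2 mulrA ltr_pM2r //; case/andP: n01.
have := lyapunov_rate_bound n01 n2 n21 w4 e01 p0.
move: t0 hW t1 t2 t3 t4 t5 t6; rewrite !ler_norml.
clear; move=> t0 hW /andP[t1 _] /andP[t2 _] /andP[_ t3].
move=> /andP[t4 _] /andP[t5 _] /andP[_ t6].
rewrite mulNr; set a0 := sigma ^+ 2 * b * S / 2 * _ in t0 *; set a1 := sigma * x * _ in t1 *.
set a2 := _ * zeta in t2 *; set a3 := _ * (S / 2 * _ + _) in t3 *.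
set a4 := _ * (x * y) in t4 *; set a5 := _ * y * (1 - _ + _) in t5 *.
set a6 := _ * y ^+ 2 in t6 *.
clearbody a0 a1 a2 a3 a4 a5 a6; lra.
Qed.

End IncoherentStar.

(** * Averaging identity and trapping of the incoherent star *)

Section IncoherentStarBarrier.
Context {R : realType}.

(** Since e beta = b, one has e g = - 1 - sigma b s: differentiating an O(e) correction along the
    fast rotation gives terms of order one. The linear correction cancels sigma x and leaves -
    sigma^2 b x s; the quadratic ones then replace x (x S + y K) by S (x^2 + y^2) / 2. *)
Lemma lyapunov_rate (x y S K sigma e beta zeta : R) :
  e * (beta - 1) = 1 ->
  let b := 1 + e in
  let s := x * S + y * K + zeta in
  let g := 1 - beta - sigma * beta * s in
  let dx := sigma / 2 * (1 - x ^+ 2 + y ^+ 2) - g * y in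
  let dy := g * x - sigma * x * y in
  let c1 := - (sigma ^+ 2 * b * S / 2) in
  let c2 := - (sigma ^+ 2 * b * K / 2) in
  x * dx + x * dx + (y * dy + y * dy)
    + e * (sigma * dy + (c1 * (x * dy + y * dx) + c2 * (y * dy + y * dy))) =
  - (sigma ^+ 2 * b * S / 2) * (x ^+ 2 + y ^+ 2) - sigma * x * (x ^+ 2 + y ^+ 2)
  - sigma ^+ 2 * b * x * zeta
  + sigma ^+ 3 * b ^+ 2 * s * (S / 2 * (x ^+ 2 - y ^+ 2) + K * (x * y))
  - e * sigma ^+ 2 * (x * y)
  - e * (sigma ^+ 3 * b * S / 4) * y * (1 - 3 * x ^+ 2 + y ^+ 2)
  + e * sigma ^+ 3 * b * K * x * y ^+ 2.
Proof.
move=> heb b s g dx dy c1 c2.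
have e0 : e != 0 by apply/eqP => e0; move: heb; rewrite e0 mul0r => /eqP; rewrite eq_sym oner_eq0.
rewrite /dx /dy /g /c1 /c2 /s /b.
have -> : beta = 1 + e^-1 by rewrite -[beta](subrK 1) -[beta - 1](mulKf e0) heb mulr1 addrC.
by field.
Qed.

(** [V] differs from |u|^2 = x^2 + y^2 by at most r^2 / 2. So [V] starts below r^2, and [V = r^2]
    forces r^2 / 2 <= |u|^2 <= 3 r^2 / 2, an annulus on which the rate is negative. The annulus
    avoids the origin, where the damping vanishes. *)
Lemma incoherent_star (T S K sigma w e beta r p : R) (x y zeta : R -> R) :
  0 < S <= 1 -> 0 <= K <= 1 -> 4 <= sigma <= w -> 0 < e <= 1 ->
  e * (beta - 1) = 1 -> 0 < r <= 4^-1 -> 0 <= p ->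
  64 * w ^+ 3 * r <= S -> 32 * w ^+ 3 * p <= S * r ->
  32 * w ^+ 3 * e <= S * r -> 6 * w ^+ 2 * e <= r ^+ 2 ->
  {within `[0, T[, continuous x} -> {within `[0, T[, continuous y} ->
  x 0 ^+ 2 + y 0 ^+ 2 <= r ^+ 2 / 4 ->
  (forall t, 0 <= t < T -> x t ^+ 2 + y t ^+ 2 <= 1) ->
  (forall t, 0 <= t < T -> x t ^+ 2 + y t ^+ 2 <= 4^-1 ->
     `|zeta t| <= p + 2 * (x t ^+ 2 + y t ^+ 2)) ->
  (forall t, 0 < t < T ->
     let g := 1 - beta - sigma * beta * (x t * S + y t * K + zeta t) in
     is_derive t 1 x (sigma / 2 * (1 - x t ^+ 2 + y t ^+ 2) - g * y t) /\
     is_derive t 1 y (g * x t - sigma * x t * y t)) ->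
  forall t, 0 <= t < T -> x t ^+ 2 + y t ^+ 2 <= 2 * r ^+ 2.
Proof.
move=> S01 K01 sw e01 heb r0 p0 hr hp he1 he2 cx cy init dom hz dxy t tT.
have T0 : (0 : R) <= 0 < T by rewrite lexx /=; case/andP: tT; exact: le_lt_trans.
pose b := 1 + e.
pose c1 := - (sigma ^+ 2 * b * S / 2).
pose c2 := - (sigma ^+ 2 * b * K / 2).
pose V t := lyapunov e sigma c1 c2 (x t) (y t).
have S01' : 0 <= S <= 1 by move: S01; clear; lra.
have e01' : 0 <= e <= 1 by move: e01; clear; lra.
have nsq u : Num.sqrt (x u ^+ 2 + y u ^+ 2) ^+ 2 = x u ^+ 2 + y u ^+ 2.
  by rewrite sqr_sqrtr // addr_ge0 // sqr_ge0.
have close u : 0 <= u < T -> `|V u - (x u ^+ 2 + y u ^+ 2)| <= r ^+ 2 / 2.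
  move=> uT; rewrite -nsq.
  apply: le_trans (lyapunov_dist (esym (nsq u)) _ S01' K01 sw e01') _; last first.
    by move: he2; clear; lra.
  by rewrite sqrtr_ge0 -(ler_pXn2r (ltn0Sn 1)) ?nnegrE ?sqrtr_ge0 // nsq expr1n dom.
have r2 : 0 < r ^+ 2 by rewrite exprn_gt0 //; case/andP: r0.
have main u : 0 <= u < T -> V u < r ^+ 2.
  apply: (@barrier R unit T (fun=> V) (fun=> r ^+ 2) _ _ _ u tt).
  - move=> _ v; rewrite /V /lyapunov.
    apply: cvgD; first by apply: cvgD; apply: cvgM; [exact: cx|exact: cx|exact: cy|exact: cy].
    apply: cvgM; first exact: cvg_cst.
    apply: cvgD; first by apply: cvgM; [exact: cvg_cst | exact: cy].
    apply: cvgD; (apply: cvgM; first exact: cvg_cst); apply: cvgM;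
      by [exact: cx | exact: cy].
  - move=> _; have := close 0 T0; rewrite ler_norml.
    by move: init r2; clear; lra.
  - move=> v _ vT _ Vv; have vT' : 0 <= v < T by move: vT; clear; lra.
    have [dx dy] := dxy v vT.
    eexists.
      exact: (is_deriveD (is_deriveD (is_deriveM dx dx) (is_deriveM dy dy))
        (is_deriveZ e (is_deriveD (is_deriveZ sigma dy) (is_deriveD
          (is_deriveZ c1 (is_deriveM dx dy)) (is_deriveZ c2 (is_deriveM dy dy)))))).
    have := lyapunov_rate (x v) (y v) S K sigma (zeta v) heb => /=.
    rewrite -/b -/c1 -/c2 => /[dup] E; rewrite /GRing.scale /= => ->.
    set n := Num.sqrt (x v ^+ 2 + y v ^+ 2).
    have nE : x v ^+ 2 + y v ^+ 2 = n ^+ 2 by rewrite nsq.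
    have n0 : 0 <= n := sqrtr_ge0 _.
    have hn : r ^+ 2 / 2 <= n ^+ 2 <= 3 / 2 * r ^+ 2.
      have := close v vT'; rewrite Vv nE ler_norml; clear; lra.
    have rn : r / 2 <= n.
      rewrite -(ler_pXn2r (ltn0Sn 1)) ?nnegrE //; last by move: r0; clear; lra.
      by move: hn r2; clear; lra.
    have n12 : n <= 2^-1.
      rewrite -(ler_pXn2r (ltn0Sn 1)) ?nnegrE //.
      have : r ^+ 2 <= 4^-1 ^+ 2 by rewrite ler_pXn2r ?nnegrE //; move: r0; clear; lra.
      by move: hn; clear; lra.
    have n14 : n ^+ 2 <= 4^-1.
      have : r ^+ 2 <= 4^-1 ^+ 2 by rewrite ler_pXn2r ?nnegrE //; move: r0; clear; lra.
      by move: hn; clear; lra.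
    rewrite nE; apply: (lyapunov_rate_neg (w := w) (p := p)) => //.
    + by rewrite n12 andbT; move: rn r0; clear; lra.
    + by rewrite -nE; apply: hz => //; rewrite nE.
    (* The terms in n^2, p and e cost at most 3/4, 1 and 1 times S r, against 8 S n >= 4 S r. *)
    + have A0 : 0 <= w ^+ 3 by rewrite exprn_ge0 //; move: sw; clear; lra.
      set A := w ^+ 3 in A0 hr hp he1 *.
      have h1 : A * n ^+ 2 <= A * (3 / 2 * r ^+ 2) by apply: ler_wpM2l => //; case/andP: hn.
      have h2 : (64 * A * r) * r <= S * r.
        by apply: ler_wpM2r => //; move: r0; clear; lra.
      have h3 : S * r / 2 <= S * n.
        by rewrite -mulrA; apply: ler_wpM2l => //; case/andP: S01'.
      have h4 : 0 < S * r by rewrite mulr_gt0 //; [case/andP: S01 | case/andP: r0].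
      by move: h1 h2 h3 h4 hp he1; clear; lra.
have := main t tT; have := close t tT; rewrite ler_norml; move: r2; clear; lra.
Qed.

End IncoherentStarBarrier.

(** * The coupled stars *)

Section Coordinates.
Context {R : realType}.
Local Notation normc := Normc.normc.

Section Paths.
Variables (V : normedModType R) (Om : set V) (F : V -> V) (T : R) (X : R -> V).
Variable f : V -> R.
Hypotheses (fB : forall u v, f (u - v) = f u - f v)
  (fZ : forall a u, f (a *: u) = a * f u) (cf : continuous f).
Hypothesis solX : is_solution Om F T X.

Lemma solution_coord_continuous : {within `[0, T[, continuous (f \o X)}.
Proof.
have [_ cX _] := solX.
by move=> t; apply: cvg_comp; [exact: cX | exact: cf].
Qed.

Lemma solution_coord_derive (t : R) : 0 < t < T ->
  is_derive t 1 (f \o X) (f (F (X t))).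
Proof.
have [_ _ dX] := solX.
by move=> tT; apply: is_derive_linear_comp => //; exact: dX.
Qed.

End Paths.

Lemma fst_continuous (U V : normedModType R) :
  continuous (fst : (U * V)%type -> U).
Proof. by move=> s; exact: (@cvg_fst _ _ (nbhs s.1) (nbhs s.2)). Qed.

Lemma snd_continuous (U V : normedModType R) :
  continuous (snd : (U * V)%type -> V).
Proof. by move=> s; exact: (@cvg_snd _ _ (nbhs s.1) (nbhs s.2)). Qed.

Lemma comp_continuous (U V W : normedModType R) (f : U -> V) (g : V -> W) :
  continuous f -> continuous g -> continuous (fun x => g (f x)).
Proof. by move=> cf cg s; apply: continuous_comp; [exact: cf | exact: cg]. Qed.

Lemma relP_continuous N j : continuous (fun s : state R N => relP s.1 0 j).
Proof.
have c := comp_continuous (@fst_continuous (plus_state R N) (minus_state R N))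
  (@snd_continuous R 'rV[R]_N).
exact: (comp_continuous c (fun s => @coord_continuous R 1 N 0 j s)).
Qed.

Lemma thetaM_continuous N j : continuous (fun s : state R N => thetaM s.2 0 j).
Proof.
have c := comp_continuous (@snd_continuous (plus_state R N) (minus_state R N))
  (@snd_continuous (R * (R * R) * R)%type 'rV[R]_N).
exact: (comp_continuous c (fun s => @coord_continuous R 1 N 0 j s)).
Qed.

Lemma alphaM_continuous N : continuous (fun s : state R N => s.2.1.1.2).
Proof.
have c := comp_continuous (@snd_continuous (plus_state R N) (minus_state R N))
  (@fst_continuous (R * (R * R) * R)%type 'rV[R]_N).
exact: (comp_continuous (comp_continuous c (@fst_continuous _ _))
  (@snd_continuous _ _)).
Qed.

Lemma rV_coord_le n (v : 'rV[R]_n) j : `|v 0 j| <= `|v|.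
Proof.
by rewrite [leRHS]/Num.norm /= mx_normrE; exact: (le_bigmax _ (fun ij => `|v ij.1 ij.2|) (0, j)).
Qed.

Lemma with_hub0 N (hub : R) (rel : 'I_N -> R) : with_hub hub rel ord0 = hub.
Proof. by rewrite /with_hub unlift_none. Qed.

Lemma with_hub_lift N (hub : R) (rel : 'I_N -> R) j :
  with_hub hub rel (lift ord0 j) = rel j + hub.
Proof. by rewrite /with_hub liftK. Qed.

Lemma fcoefE (delta sigma : R) :
  fcoef delta sigma = Complex (sigma / 2 * sin delta) (sigma / 2 * cos delta).
Proof.
rewrite /fcoef; have h : (2 * Complex 0 1 : R[i]) != 0.
  by rewrite mulf_neq0 // ?pnatr_eq0 // eq_complex /= oner_eq0 andbF.
apply: (canLR (mulfK h)); apply/eqP.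
by rewrite eq_complex /= cosN sinN; apply/andP; split; apply/eqP; field.
Qed.

Lemma gcoefE (delta beta sigma : R) (z : R[i]) :
  gcoef delta beta sigma z =
  Complex (1 - beta - sigma * beta *
    (complex.Re z * sin delta + complex.Im z * cos delta)) 0.
Proof.
case: z => a b; have h : (2 * Complex 0 1 : R[i]) != 0.
  by rewrite mulf_neq0 // ?pnatr_eq0 // eq_complex /= oner_eq0 andbF.
rewrite /gcoef (_ : _ / _ = Complex (a * sin delta + b * cos delta) 0).
  apply/eqP; rewrite eq_complex /=; apply/andP; split; apply/eqP; ring.
apply: (canLR (mulfK h)); apply/eqP.
by rewrite eq_complex /= cosN sinN; apply/andP; split; apply/eqP; ring.
Qed.

(* The coordinates [x + i y = e^{-i delta} alpha] of the incoherent star. *)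
Definition rotRe N (delta : R) (s : state R N) : R :=
  complex.Re (alphaM s.2) * cos delta + complex.Im (alphaM s.2) * sin delta.

Definition rotIm N (delta : R) (s : state R N) : R :=
  complex.Im (alphaM s.2) * cos delta - complex.Re (alphaM s.2) * sin delta.

(* [Im ((z - alpha) e^{i delta})], by which [g] differs from its value at
   [z = alpha]. *)
Definition zmean_error N (delta : R) (s : state R N) : R :=
  let z := zmean (alphaM s.2) (psiM s.2) (thetaM s.2) - alphaM s.2 in
  complex.Re z * sin delta + complex.Im z * cos delta.

Lemma rot_normc N (delta : R) (s : state R N) :
  rotRe delta s ^+ 2 + rotIm delta s ^+ 2 = normc (alphaM s.2) ^+ 2.
Proof.
rewrite normc_sqr /rotRe /rotIm; have := cos2Dsin2 delta.
set c := cos delta; set d := sin delta => cd.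
set a := complex.Re _; set b := complex.Im _.
transitivity ((a ^+ 2 + b ^+ 2) * (c ^+ 2 + d ^+ 2)); first by ring.
by rewrite cd mulr1.
Qed.

Lemma zmean_error_le N (delta : R) (s : state R N) :
  `|zmean_error delta s|
    <= normc (zmean (alphaM s.2) (psiM s.2) (thetaM s.2) - alphaM s.2).
Proof.
rewrite /zmean_error; set z := _ - _.
have := Im_le_normc (z * expi delta).
by rewrite Normc.normcM normc_expi mulr1; case: z.
Qed.

(** As f = (sigma / 2) i e^{- i delta}, the equation for u = e^{- i delta} alpha is u' = (sigma /
    2)(1 - u^2) + i g u with [g] real. In [g], alpha e^{i delta} = u e^{2 i delta} produces the
    angle 2 delta. *)
Lemma lifted_field_rot N (delta beta sigma eps : R) h A I (s : state R N) :
  let x := rotRe delta s in let y := rotIm delta s in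
  let g := 1 - beta - sigma * beta *
     (x * sin (2 * delta) + y * cos (2 * delta) + zmean_error delta s) in
  let F := lifted_field delta beta sigma eps h A I s in
  rotRe delta F = sigma / 2 * (1 - x ^+ 2 + y ^+ 2) - g * y /\
  rotIm delta F = g * x - sigma * x * y.
Proof.
move=> x y g F.
have e2 : cos (2 * delta) = cos delta ^+ 2 - sin delta ^+ 2.
  by rewrite mulr_natl mulr2n cosD !expr2.
have e2' : sin (2 * delta) = 2 * sin delta * cos delta.
  by rewrite mulr_natl mulr2n sinD; ring.
have cd := cos2Dsin2 delta.
pose z := zmean (alphaM s.2) (psiM s.2) (thetaM s.2).
have gE : gcoef delta beta sigma z = Complex g 0.
  rewrite gcoefE /g /x /y /rotRe /rotIm /zmean_error -/z e2 e2'.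
  move: cd; case: (alphaM s.2) (z) => a b [z1 z2] /=.
  set c := cos delta; set d := sin delta => cd; congr Complex.
  congr (_ - _ * _).
  transitivity (z1 * d + z2 * c + (a * d + b * c) * ((c ^+ 2 + d ^+ 2) - 1));
    last by ring.
  by rewrite cd subrr mulr0 addr0.
have -> : rotRe delta F = complex.Re (Complex 0 1 * (fcoef delta sigma * alphaM s.2 ^+ 2
   + gcoef delta beta sigma z * alphaM s.2 + conjc (fcoef delta sigma))) * cos delta
   + complex.Im (Complex 0 1 * (fcoef delta sigma * alphaM s.2 ^+ 2
   + gcoef delta beta sigma z * alphaM s.2 + conjc (fcoef delta sigma))) * sin delta.
  by [].
have -> : rotIm delta F = complex.Im (Complex 0 1 * (fcoef delta sigma * alphaM s.2 ^+ 2
   + gcoef delta beta sigma z * alphaM s.2 + conjc (fcoef delta sigma))) * cos delta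
   - complex.Re (Complex 0 1 * (fcoef delta sigma * alphaM s.2 ^+ 2
   + gcoef delta beta sigma z * alphaM s.2 + conjc (fcoef delta sigma))) * sin delta.
  by [].
rewrite gE fcoefE {gE e2 e2'}; clearbody g; rewrite {F z}/x {}/y /rotRe /rotIm.
move: cd; case: (alphaM s.2) => a b.
set c := cos delta; set d := sin delta => cd.
rewrite expr2 /=; clearbody c d; split.
- transitivity (sigma / 2 * ((c ^+ 2 + d ^+ 2) - ((a * c + b * d) ^+ 2
      - (b * c - a * d) ^+ 2) * 1) - g * (b * c - a * d)); last by rewrite cd; ring.
  have -> : (a * c + b * d) ^+ 2 - (b * c - a * d) ^+ 2
     = (a ^+ 2 - b ^+ 2) * (c ^+ 2 - d ^+ 2) + 4 * (a * b * c * d) by ring.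
  by field.
- by field.
Qed.

Lemma lifted_field_theta N (delta beta sigma eps : R) h A (I : {set 'I_N})
    (s : state R N) j : j \notin I ->
  thetaM (lifted_field delta beta sigma eps h A I s).2 0 j = 0.
Proof. by move=> jI; rewrite /= /thetaM /= mxE (negbTE jI). Qed.

(** The hub row of [A] vanishes, so no forcing enters through the hub. A leaf row has at most its
    diagonal entry, so the forcing is a single value of [h], bounded independently of [N] and
    [beta]. *)
Lemma lifted_field_rel N (delta beta sigma eps H : R) h A (I : {set 'I_N})
    (s : state R N) j :
  0 <= eps -> (forall x, `|h x| <= H) -> sparse_coupling I A ->
  exists2 p, `|p| <= eps * H &
  relP (lifted_field delta beta sigma eps h A I s).1 0 j =
    1 + sigma * sin (delta - relP s.1 0 j) + p
    - (beta + beta * (sigma / N%:R) * \sum_k sin (relP s.1 0 k + delta)).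
Proof.
move=> eps0 hH [A1 A0].
pose q := \sum_k A (lift ord0 j) k * h (phases_plus s.1 (lift ord0 j) - phases_minus s.2 k).
exists (eps * q).
  rewrite normrM ger0_norm //; apply: ler_wpM2l => //.
  rewrite /q (bigD1 (lift ord0 j)) //= big1 ?addr0; last first.
    move=> k kj; rewrite A0 ?mul0r // => -[i iI [/lift_inj ji ki]].
    by move: kj; rewrite ki ji eqxx.
  have H0 : 0 <= H by apply: le_trans (hH 0).
  case: (boolP (j \in I)) => jI; first by rewrite A1 // mul1r.
  rewrite A0 ?mul0r ?normr0 // => -[i iI [/lift_inj ji _]].
  by move: jI; rewrite ji iI.
rewrite /= /relP /= mxE /star_rate eqxx -/q.
rewrite (_ : (lift ord0 j == ord0) = false); last first.
  by apply/negbTE; rewrite eq_sym neq_lift.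
rewrite /phases_plus with_hub0 with_hub_lift.
rewrite [X in - (_ + eps * X)](_ : _ = 0); last first.
  rewrite big1 // => k _; rewrite A0 ?mul0r // => -[i iI [/eqP]].
  by rewrite (negbTE (neq_lift _ _)).
rewrite mulr0 addr0; congr (_ + _ * sin _ + _ - (_ + _ * _)).
- by rewrite /relP /hubP; ring.
- by apply: eq_bigr => k _; rewrite with_hub_lift addrK.
Qed.

End Coordinates.

(** * Order parameters along solutions of the coupled system *)

Section CoupledStars.
Context {R : realType} (N : nat).
Variables (delta beta sigma eps H : R) (h : R -> R) (A : 'M[R]_N.+1) (I : {set 'I_N}).
Hypotheses (hdelta : 0 < delta < pi / 4) (N2 : (2 < N)%N).
Hypotheses (eps0 : 0 <= eps) (hH : forall x, `|h x| <= H) (hA : sparse_coupling I A).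
Variables (T : R) (X : R -> state R N).
Hypothesis solX : is_solution (@domain R N)
  (lifted_field delta beta sigma eps h A I) T X.
Local Notation normc := Normc.normc.

Let N0 : (0 < N)%N. Proof. exact: ltn_trans N2. Qed.

(** Rotating by - phi0 and taking the real part bounds the order parameter below by the mean of
    cos(phi_j - phi0). The integers [m] allow each phase to be close only modulo full turns. *)
Lemma order_plus_ge (s : state R N) (phi0 mu : R) :
  (forall j, exists m : int, `|relP s.1 0 j - 2 * pi * m%:~R - phi0| <= mu) ->
  1 - mu <= order_plus s.
Proof.
move=> hs; rewrite /order_plus.
have -> : normc (N%:R^-1 * \sum_j expi (relP s.1 0 j))
    = normc (N%:R^-1 * \sum_j (expi (- phi0) * expi (relP s.1 0 j))).
  by rewrite -mulr_sumr mulrCA [RHS]Normc.normcM normc_expi mul1r.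
apply: le_trans (Re_le_normc _).
have ReM (z : R[i]) : complex.Re (N%:R^-1 * z) = N%:R^-1 * complex.Re z.
  have -> : (N%:R^-1 : R[i]) = Complex N%:R^-1 0.
    apply: (mulfI (natc_neq0 N0)); rewrite divff ?natc_neq0 //.
    have -> : (N%:R : R[i]) = Complex N%:R 0 by rewrite -[RHS]/(real_complex R _) rmorph_nat.
    apply/eqP; rewrite eq_complex /= !(mulr0, mul0r, subr0, addr0) eqxx andbT.
    by rewrite divff // pnatr_eq0 -lt0n.
  by case: z => a b /=; rewrite mul0r subr0.
rewrite ReM mulrC ler_pdivlMr ?ltr0n //.
have -> : complex.Re (\sum_j (expi (- phi0) * expi (relP s.1 0 j)))
   = \sum_j cos (relP s.1 0 j - phi0).
  have ReD : {morph (@complex.Re R) : x y / x + y} by move=> [? ?] [? ?].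
  rewrite (big_morph _ ReD (erefl : complex.Re 0 = 0)).
  by apply: eq_bigr => j _; rewrite -expiD addrC.
have -> : (1 - mu) * N%:R = \sum_(j < N) (1 - mu).
  by rewrite sumr_const card_ord mulr_natr.
apply: ler_sum => j _; have [m hm] := hs j.
have -> : cos (relP s.1 0 j - phi0) = cos (relP s.1 0 j - 2 * pi * m%:~R - phi0).
  have := expi_period (relP s.1 0 j - 2 * pi * m%:~R - phi0) m.
  by move=> /(congr1 (@complex.Re R)) /= <-; congr cos; ring.
have := @cos_near R (relP s.1 0 j - 2 * pi * m%:~R - phi0) 0 mu.
by rewrite subr0 cos0; exact.
Qed.

(** The full turns [m j] are fixed at time 0; subtracting these constants changes neither continuity
    nor the equations, and [coherent_star] applies to the shifted phases. *)
Lemma plus_star_coherent (mu : R) : let phi0 := phiC delta beta sigma in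
  1 < beta -> 4 <= sigma * cos (2 * delta) -> 0 < mu ->
  mu <= cos (2 * delta) / 4 -> mu <= 4^-1 -> 4 * (eps * H) < mu ->
  (forall j, exists m : int,
     `|relP (X 0).1 0 j - (phi0 + 2 * pi * m%:~R)| < mu / 4) ->
  forall t, 0 <= t < T -> 1 - mu <= order_plus (X t).
Proof.
move=> phi0 b1 sK mu0 muK mu4 e_mu /choice[m hm] t tT.
have [eqphi cm cp] := phiC_properties hdelta b1 sK.
apply: (@order_plus_ge _ phi0) => j; exists (m j); rewrite ltW //.
have shift (x : R) i : sin (x + 2 * pi * (m i)%:~R) = sin x.
  by have /(congr1 (@complex.Im R)) := expi_period x (m i).
pose rel i (s : state R N) : R := relP s.1 0 i.
have relB i u v : rel i (u - v) = rel i u - rel i v by rewrite /rel /relP !mxE.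
have relZ i a u : rel i (a *: u) = a * rel i u by rewrite /rel /relP !mxE.
have relC i : continuous (rel i) by exact: relP_continuous.
apply: (@coherent_star R N T delta beta sigma phi0 (cos (2 * delta)) mu (eps * H)
  (fun i t => rel i (X t) - 2 * pi * (m i)%:~R)) => //.
- by move: b1; lra.
- exact: cos2delta_gt0.
- move=> i u.
  have c : {within `[0, T[, continuous (rel i \o X)}.
    exact: (solution_coord_continuous (relC i) solX).
  exact: (cvgB (c u) (cvg_cst (2 * pi * (m i)%:~R : R))).
- by move=> i; have := hm i; rewrite opprD addrA addrAC.
- move=> i u uT.
  have [p hp hF] := lifted_field_rel delta beta sigma (X u) i eps0 hH hA.
  exists p => //.
  have d1 := solution_coord_derive (relB i) (relZ i) (relC i) solX uT.
  apply: (is_derive_eq (is_deriveB d1 (is_derive_cst (2 * pi * (m i)%:~R) u 1))).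
  rewrite subr0 /rel hF; congr (_ + _ * _ + _ - (_ + _ * _)).
    by rewrite -[LHS](shift _ i); congr sin; ring.
  apply: eq_bigr => k _; rewrite -[RHS](shift _ k); congr sin; ring.
Qed.

(** The uncoupled angles are constant, so the closeness to [theta0] persists outside [I] and
    [moment_dist] bounds the first two moments for all time. The bounds 2 rho + 2 kappa and 4 rho +
    2 kappa add up to the [p] of [incoherent_star]. *)
Lemma minus_star_incoherent (w e r rho kappa : R) (theta0 : 'rV[R]_N) :
  let S := sin (2 * delta) in
  4 <= sigma <= w -> 0 < e <= 1 -> e * (beta - 1) = 1 -> 0 < r <= 4^-1 ->
  0 <= rho -> 0 <= kappa ->
  64 * w ^+ 3 * r <= S -> 32 * w ^+ 3 * (6 * rho + 4 * kappa) <= S * r ->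
  32 * w ^+ 3 * e <= S * r -> 6 * w ^+ 2 * e <= r ^+ 2 ->
  #|I|%:R <= kappa * N%:R ->
  uniform_states R N theta0 -> `|thetaM (X 0).2 - theta0| < rho ->
  normc (alphaM (X 0).2) <= r / 2 ->
  forall t, 0 <= t < T ->
    order_minus (X t) <= 2 * r + (6 * rho + 4 * kappa) + 4 * r ^+ 2.
Proof.
move=> S sw e01 heb r0 rho0 kap0 hr hp he1 he2 hI unif near0 alpha0 t tT.
have [dom _ _] := solX.
pose ang j (s : state R N) : R := thetaM s.2 0 j.
have angB j u v : ang j (u - v) = ang j u - ang j v by rewrite /ang /thetaM !mxE.
have angZ j a u : ang j (a *: u) = a * ang j u by rewrite /ang /thetaM !mxE.
have angC j : continuous (ang j) by exact: thetaM_continuous.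
have theta_close u : 0 <= u < T -> forall j, j \notin I ->
    `|thetaM (X u).2 0 j - theta0 0 j| <= rho.
  move=> uT j jI.
  have -> : thetaM (X u).2 0 j = thetaM (X 0).2 0 j.
    apply: (zero_derive_constant (solution_coord_continuous (angC j) solX)) uT.
    move=> v vT; apply: is_derive_eq.
      exact: (solution_coord_derive (angB j) (angZ j) (angC j) solX vT).
    exact: lifted_field_theta.
  apply: le_trans (ltW near0).
  by have := rV_coord_le (thetaM (X 0).2 - theta0) j; rewrite !mxE.
have zdist u : 0 <= u < T -> normc (alphaM (X u).2) <= 2^-1 ->
    normc (zmean (alphaM (X u).2) (psiM (X u).2) (thetaM (X u).2) - alphaM (X u).2)
    <= 6 * rho + 4 * kappa + 2 * normc (alphaM (X u).2) ^+ 2.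
  move=> uT ha; apply: le_trans (zmean_dist _ _ N0 ha) _; rewrite lerD2r.
  have := moment_dist 1 N0 rho0 (theta_close u uT) hI.
  have := moment_dist 2 N0 rho0 (theta_close u uT) hI.
  rewrite !(moment_uniform _ _ unif) // !subr0; lra.
have rotReB (u v : state R N) : rotRe delta (u - v) = rotRe delta u - rotRe delta v :> R.
  by rewrite /rotRe /alphaM /=; ring.
have rotImB (u v : state R N) : rotIm delta (u - v) = rotIm delta u - rotIm delta v :> R.
  by rewrite /rotIm /alphaM /=; ring.
have rotReZ a (u : state R N) : rotRe delta (a *: u) = a * rotRe delta u.
  by rewrite /rotRe /alphaM /= /GRing.scale /=; ring.
have rotImZ a (u : state R N) : rotIm delta (a *: u) = a * rotIm delta u.
  by rewrite /rotIm /alphaM /= /GRing.scale /=; ring.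
have cRe : continuous (fun s : state R N => complex.Re (alphaM s.2)).
  exact: (comp_continuous (@alphaM_continuous R N) (@fst_continuous R R R)).
have cIm : continuous (fun s : state R N => complex.Im (alphaM s.2)).
  exact: (comp_continuous (@alphaM_continuous R N) (@snd_continuous R R R)).
have rotReC : continuous (@rotRe R N delta).
  move=> s; apply: cvgD; apply: cvgM; by [exact: cRe | exact: cIm | exact: cvg_cst].
have rotImC : continuous (@rotIm R N delta).
  move=> s; apply: cvgB; apply: cvgM; by [exact: cRe | exact: cIm | exact: cvg_cst].
have S01 : 0 < S <= 1 by rewrite sin2delta_gt0 // sin_le1.
have K01 : 0 <= cos (2 * delta) <= 1 by rewrite ltW ?cos2delta_gt0 // cos_le1.
have small u : 0 <= u < T -> normc (alphaM (X u).2) ^+ 2 <= 2 * r ^+ 2.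
  move=> uT; rewrite -(rot_normc delta).
  apply: (@incoherent_star R T S (cos (2 * delta)) sigma w e beta r
    (6 * rho + 4 * kappa) (rotRe delta \o X) (rotIm delta \o X)
    (zmean_error delta \o X)) uT => //=.
  - by move: rho0 kap0; lra.
  - exact: (solution_coord_continuous rotReC solX).
  - exact: (solution_coord_continuous rotImC solX).
  - rewrite rot_normc (le_trans (_ : _ <= (r / 2) ^+ 2)) //.
      by rewrite ler_pXn2r ?nnegrE ?normc_ge0 //; move: r0; lra.
    by rewrite exprMn; lra.
  - by move=> v vT; rewrite rot_normc expr_le1 ?normc_ge0 // ltW //; exact: dom.
  - move=> v vT; rewrite rot_normc => hv.
    apply: le_trans (zmean_error_le _ _) (zdist v vT _).
    rewrite -(ler_pXn2r (ltn0Sn 1)) ?nnegrE ?normc_ge0 //.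
    by rewrite (le_trans hv) // exprVn; lra.
  - move=> v vT.
    have [eRe eIm] := lifted_field_rot delta beta sigma eps h A I (X v).
    split.
      have d := solution_coord_derive rotReB rotReZ rotReC solX vT.
      by apply: (is_derive_eq d); exact: eRe.
    have d := solution_coord_derive rotImB rotImZ rotImC solX vT.
    by apply: (is_derive_eq d); exact: eIm.
have r2 : r ^+ 2 <= r / 4 by rewrite expr2; apply: ler_wpM2l; move: r0; lra.
have n2r : normc (alphaM (X t).2) <= 2 * r.
  rewrite -(ler_pXn2r (ltn0Sn 1)) ?nnegrE ?normc_ge0 //; last first.
    by move: r0; lra.
  by rewrite (le_trans (small t tT)) // exprMn; have := sqr_ge0 r; lra.
have n12 : normc (alphaM (X t).2) <= 2^-1 by move: n2r r0; lra.
have := zdist t tT n12; have := small t tT.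
rewrite /order_minus; set z := zmean _ _ _; set al := alphaM _ in n2r *.
by have := normcD (z - al) al; rewrite subrK; move: n2r; lra.
Qed.

End CoupledStars.

(** * Choice of the constants and conclusion *)

Lemma normc_to_complex_le (R : realType) (g : R * R) (c : R) :
  `|g| <= c -> Normc.normc (to_complex g) <= 2 * c.
Proof.
move=> gc; have /andP[g1 g2] : (`|g.1| <= c) && (`|g.2| <= c) by rewrite -ge_max.
by rewrite (le_trans (normc_le_ReIm _)) // mulr_natl mulr2n lerD.
Qed.

Theorem theorem4p4 (R : realType) (delta : R) (hdelta : 0 < delta < pi / 4)
    (h : R -> R) (h_per : forall x, h (x + 2 * pi) = h x)
    (h_C1 : C1_on setT h) (eta : R) (heta : 0 < eta) :
  (* rho bounds the size of U and the C^1 norm of g^I; C is the implied constant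
     of O(eps), uniform in N, beta, sigma, I *)
  exists (N0 : nat) (beta0 kappa rho : R) (calI : set R),
    [/\ (0 < N0)%N, 0 < beta0, 0 < kappa & 0 < rho] /\
    [/\ open calI, calI !=set0 &
        forall beta sigma, 1 < beta -> beta0 < beta -> calI sigma ->
          bistable delta beta sigma] /\
    forall C : R, 0 < C ->
    exists eps0 : R, 0 < eps0 /\
    forall (beta : R) (N k : nat) (I : {set 'I_N}) (A : 'M[R]_N.+1),
      1 < beta -> beta0 < beta -> (N0 < N)%N -> k%:R <= kappa * N%:R ->
      #|I| = k -> sparse_coupling I A ->
    forall (eps sigma : R), 0 < eps <= eps0 -> calI sigma ->
    forall (U : set 'rV[R]_N) (gI : 'rV[R]_(1 + N) -> R * R)
      (tgC : 'I_N -> 'rV[R]_(1 + (1 + (1 + N))) -> R)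
      (tgI : 'rV[R]_(1 + (1 + (1 + N))) -> R * R) (omega : R),
      small_nbhd rho U ->
      is_M_minus delta beta sigma U gI rho ->
      0 < omega ->
      is_M_eps delta beta sigma U gI tgC tgI eps h A I omega C ->
    forall (T : R) (X : R -> state R N),
      is_solution (@domain R N)
        (lifted_field delta beta sigma eps h A I) T X ->
      M_eps delta beta sigma U gI tgC tgI (X 0) ->
    forall t : R, 0 <= t < T ->
      order_plus (X t) > 1 - eta /\ order_minus (X t) < eta.
Proof.
have K0 := cos2delta_gt0 hdelta.
have K1 : cos (2 * delta) <= 1 := cos_le1 _.
have S0 := sin2delta_gt0 hdelta.
have S1 : sin (2 * delta) <= 1 := sin_le1 _.
have [H H0 hH] := C1_periodic_bounded h_per h_C1.
set K := cos (2 * delta) in K0 K1 *; set S := sin (2 * delta) in S0 S1 *.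
(* The interval of admissible [sigma] will be ]4 / K, w[: its lower end gives sigma K >= 4, its
   upper end the uniform bound. *)
pose w := 4 / K + 1.
have w5 : 5 <= w.
  have : 4 <= 4 / K by rewrite ler_pdivlMr //; lra.
  by rewrite /w; lra.
have w1 : 1 <= w by lra.
have w0 : 0 <= w by lra.
have w31 : 1 <= w ^+ 3 by rewrite exprn_ege1.
have w30 : 0 < w ^+ 3 := lt_le_trans ltr01 w31.
pose r := Num.min (eta / 8) (S / (64 * w ^+ 3)).
have r0 : 0 < r by rewrite lt_min !divr_gt0 //; lra.
have r_eta : r <= eta / 8 by rewrite ge_min lexx.
have r_S : 64 * w ^+ 3 * r <= S.
  by rewrite mulrC -ler_pdivlMr ?ge_min ?lexx ?orbT //; lra.
have r4 : r <= 4^-1 by nra.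
have Sr0 : 0 < S * r by rewrite mulr_gt0.
have Srr : S * r <= r by rewrite ler_piMl // ltW.
have r20 : 0 < r ^+ 2 by rewrite exprn_gt0.
(* The same number serves as [rho] and [kappa], so 6 rho + 4 kappa = 10 rho saturates the smallness
   condition on [p]. *)
pose rho := S * r / (320 * w ^+ 3).
have rho0 : 0 < rho by rewrite divr_gt0 // mulr_gt0.
have rhoE : 32 * w ^+ 3 * (6 * rho + 4 * rho) = S * r.
  by rewrite /rho; field; rewrite gt_eqF //; lra.
have rho_r : 10 * rho <= r / 32.
  have : rho <= w ^+ 3 * rho by rewrite ler_peMl // ltW.
  by move: rhoE; lra.
(* The summand 4 w^2 secures bistability; the last two make e = 1 / (beta - 1) small enough for the
   averaging. *)
pose B := 1 + 4 * w ^+ 2 + 32 * w ^+ 3 / (S * r) + 6 * w ^+ 2 / r ^+ 2.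
pose mu := Num.min (Num.min (K / 4) 4^-1) (eta / 2).
have mu0 : 0 < mu by rewrite !lt_min -andbA; apply/and3P; split; lra.
have muK : mu <= K / 4 by rewrite !ge_min lexx.
have mu4 : mu <= 4^-1 by rewrite !ge_min lexx orbT.
have mu_eta : mu <= eta / 2 by rewrite !ge_min lexx !orbT.
have q1 : 0 <= 32 * w ^+ 3 / (S * r)
  by apply: divr_ge0; [apply: mulr_ge0 => //; exact: ltW | exact: ltW].
have q2 : 0 <= 6 * w ^+ 2 / r ^+ 2.
  by rewrite divr_ge0 ?sqr_ge0 // mulr_ge0 ?sqr_ge0.
have w25 : 25 <= w ^+ 2 by rewrite expr2; nra.
have B0 : 0 < B by rewrite /B; lra.
have bist beta sigma : 1 < beta -> B < beta -> `]4 / K, w[%classic sigma ->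
    [/\ 4 <= sigma * K, 4 <= sigma <= w & bistable delta beta sigma].
  move=> b1 bB; rewrite /= in_itv /= => /andP[s1 s2].
  have sK : 4 <= sigma * K by rewrite -ler_pdivrMr // ltW.
  split=> //; first by rewrite (sigma_ge4 hdelta sK) ltW.
  apply: (bistable_large hdelta b1 sK (ltW s2)); move: bB; rewrite /B; lra.
exists 2%N, B, rho, rho, `]4 / K, w[%classic; split; first by split.
split.
  split; first exact: itv_open.
    by exists (4 / K + 2^-1); rewrite /= in_itv /= /w; lra.
  by move=> beta sigma b1 bB /(bist _ _ b1 bB)[].
(* One bound covers both effects of [eps]: the displacement of the manifold, at most C eps, and the
   forcing, at most H eps. *)
move=> C C0; exists (Num.min mu r / (16 * (C + H))).
have m0 : 0 < Num.min mu r by rewrite lt_min mu0.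
split; first by rewrite divr_gt0 //; lra.
move=> beta N k I A b1 bB N2 hk kI hA eps sigma /andP[eps_gt0 eps_le] sI.
move=> U gI tgC tgI omega [_ _ _ nearU] [_ [_ gI_le] _] _ [tgC_le [_ [_ tgI_le]] _].
move=> T X solX [UX rel0 alpha0] t tT.
have [sK sw [_ _ b3 _ _]] := bist beta sigma b1 bB sI.
have eCH : eps * C + eps * H <= Num.min mu r / 16.
  rewrite -mulrDr; move: eps_le; rewrite ler_pdivlMr; lra.
have mmu : Num.min mu r <= mu by rewrite ge_min lexx.
have mr : Num.min mu r <= r by rewrite ge_min lexx orbT.
have eC0 : 0 < eps * C by rewrite mulr_gt0.
have eH0 : 0 < eps * H by rewrite mulr_gt0.
split.
  rewrite (lt_le_trans (_ : _ < 1 - mu)) //; first by lra.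
  apply: (plus_star_coherent hdelta N2 (ltW eps_gt0) hH hA solX) tT => //.
    by lra.
  move=> j; have [m ->] := rel0 j; exists m.
  have [_ [_ tgCj]] := tgC_le j.
  have cancel (a b c : R) : a + b + c - (a + c) = b by ring.
  rewrite cancel.
  apply: le_lt_trans (proj1 (tgCj _ _)) _; last by rewrite mulrC; lra.
  by rewrite /base3_dom /base3 /= !row_mxKr.
pose e := (beta - 1)^-1.
have bm1 : 0 < beta - 1 by rewrite subr_gt0.
have heb : e * (beta - 1) = 1 by rewrite mulVf // gt_eqF.
have e0 : 0 < e by rewrite invr_gt0.
have e1 : e <= 1 by rewrite invf_le1 //; move: bB; rewrite /B; lra.
have he1 : 32 * w ^+ 3 * e <= S * r.
  rewrite ler_pdivrMr // [leRHS]mulrC -ler_pdivrMr //; move: bB; rewrite /B; lra.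
have he2 : 6 * w ^+ 2 * e <= r ^+ 2.
  rewrite ler_pdivrMr // [leRHS]mulrC -ler_pdivrMr //; move: bB; rewrite /B; lra.
have [theta0 unif near0] := nearU _ UX.
(* The contributions of [alphaI], [gI] and [tgI] are at most r / 32, r / 160 and r / 8. *)
have alphaX : Normc.normc (alphaM (X 0).2) <= r / 2.
  rewrite alpha0; apply: le_trans (normcD _ _) _.
  have aI := normc_alphaI hdelta b1 sK b3.
  have aI' : sigma / (beta - 1) <= w * e.
    by apply: ler_wpM2r; [exact: ltW | case/andP: sw].
  have we : w * e <= w ^+ 3 * e.
    apply: ler_wpM2r; first exact: ltW.
    by rewrite exprS ler_peMr // exprn_ege1.
  have dg := normcD (to_complex (gI (base1 (psiM (X 0).2) (thetaM (X 0).2))))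
    (to_complex (tgI (base3 (hubP (X 0).1) (hubM (X 0).2) (psiM (X 0).2) (thetaM (X 0).2)))).
  have ng : Normc.normc (to_complex (gI (base1 (psiM (X 0).2) (thetaM (X 0).2)))) <= 2 * rho.
    apply/normc_to_complex_le/(proj1 (gI_le _ _)).
    by rewrite /base1_dom /base1 /= row_mxKr.
  have nt : Normc.normc (to_complex (tgI (base3 (hubP (X 0).1) (hubM (X 0).2)
      (psiM (X 0).2) (thetaM (X 0).2)))) <= 2 * (C * eps).
    apply/normc_to_complex_le/(proj1 (tgI_le _ _)).
    by rewrite /base3_dom /base3 /= !row_mxKr.
  apply: le_trans (lerD aI dg) _; lra.
have hI : #|I|%:R <= rho * N%:R by rewrite kI.
have sw' : 4 <= sigma <= w by [].
have r04 : 0 < r <= 4^-1 by rewrite r0.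
have e01 : 0 < e <= 1 by rewrite e0.
have hp : 32 * w ^+ 3 * (6 * rho + 4 * rho) <= S * r by rewrite rhoE.
have := minus_star_incoherent hdelta N2 solX sw' e01 heb r04 (ltW rho0) (ltW rho0)
  r_S hp he1 he2 hI unif near0 alphaX tT.
(* Hence 2 r + 10 rho + 4 r^2 <= 3 r + r / 32, which is below [eta] since r <= eta / 8. *)
have : r ^+ 2 <= r / 4 by rewrite expr2; apply: ler_wpM2l => //; exact: ltW.
by lra.
Qed.
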